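(* Let $\mathcal{M}^4\subset\mathbb{R}^D$ (Euclidean signature) be an oriented embedded 4-manifold with induced metric $g_{\mu\nu}$, and let $$\theta^{-1}_{\mu\nu}=\bar\theta^{-1}_{\mu\nu}+F_{\mu\nu},\qquad F_{\mu\nu}=\partial_\mu A_\nu-\partial_\nu A_\mu,$$ where $\bar\theta^{-1}_{\mu\nu}$ is a symplectic form that is self-dual (resp. anti-self-dual) with respect to $g_{\mu\nu}$. Let $G_{\mu\nu}$, $\sigma$, $\eta$ be the effective metric and functions associated with $(g,\theta)$ as in the context, and let $h_{\mu\nu}=G_{\mu\nu}-g_{\mu\nu}$. Then, expanding in powers of $F$, the semi-classical Yang-Mills action $S_{YM}=\int\frac{d^4x}{(2\pi)^2}\sqrt{|g|}\,e^{-\sigma}\eta$ satisfies $$S_{YM}=\int\frac{d^4x}{(2\pi)^2}\sqrt{|g|}\,\Big(1+\tfrac18h_{\mu\nu}h^{\mu\nu}+O(F^3)\Big)$$ $$=\int\frac{d^4x}{(2\pi)^2}\sqrt{|g|}\,\Big(1+\tfrac14e^{\bar\sigma}F_{\mu\nu}F_{\mu'\nu'}g^{\mu\mu'}g^{\nu\nu'}-\mathrm{Pfaff}(F_{\mu\nu})\,\mathrm{Pfaff}(\bar\theta^{\mu\nu})+O(F^3)\Big)$$ $$=\int\frac{d^4x}{(2\pi)^2}\sqrt{|g|}\,\Big(1+\tfrac18e^{\bar\sigma}(F\mp\star_gF)_{\mu\nu}(F\mp\star_gF)_{\mu'\nu'}g^{\mu\mu'}g^{\nu\nu'}+O(F^3)\Big),$$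 where the upper sign ($F-\star_gF$) applies if $\bar\theta^{-1}_{\mu\nu}$ is self-dual, and the lower sign ($F+\star_gF$) if it is anti-self-dual.
   Context: Let $x^a:\mathcal{M}^4\hookrightarrow\mathbb{R}^D$ be the Cartesian embedding functions and $g_{\mu\nu}=\partial_\mu x^a\partial_\nu x^b\delta_{ab}$. For a non-degenerate Poisson tensor $\theta^{\mu\nu}$ (the inverse matrix of the symplectic form $\theta^{-1}_{\mu\nu}$) the effective metric $G_{\mu\nu}$ (with inverse $G^{\mu\nu}$) and the function $\sigma$ are defined by $$G^{\mu\nu}=e^{-\sigma}\theta^{\mu\rho}\theta^{\nu\kappa}g_{\rho\kappa},\qquad e^{-\sigma}=\frac{\sqrt{\det\theta^{-1}_{\mu\nu}}}{\sqrt{\det G_{\mu\nu}}},$$ which determine $\sigma$ uniquely; in dimension 4 one has $\det G_{\mu\nu}=\det g_{\mu\nu}$. Furthermore $\eta=\frac14e^\sigma G^{\mu\nu}g_{\mu\nu}$. $\bar\theta^{\mu\nu}$ is the inverse matrix of $\bar\theta^{-1}_{\mu\nu}$, and $\bar\sigma$ is defined by $\bar\theta^{\mu\alpha}g_{\alpha\beta}\bar\theta^{\beta\gamma}g_{\gamma\nu}=-e^{\bar\sigma}\delta^\mu_\nu$ (which holds for (anti-)self-dual $\bar\theta$). Indices of $h$ are raised with $g$. $\star_g$ is the Hodge star of $g$; a 2-form $\omega$ is self-dual (anti-self-dual) if $\star_g\omega=\omega$ ($\star_g\omega=-\omega$). The Pfaffians are $\mathrm{Pfaff}(\bar\theta^{\mu\nu})=\frac18\varepsilon_{\mu\nu\rho\kappa}\bar\theta^{\mu\nu}\bar\theta^{\rho\kappa}$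 and $\mathrm{Pfaff}(F_{\mu\nu})=\frac18\varepsilon^{\mu\nu\rho\kappa}F_{\mu\nu}F_{\rho\kappa}$, with $\varepsilon$ the totally antisymmetric Levi-Civita symbol with entries $0,\pm1$ in oriented coordinates. $O(F^3)$ denotes terms of order at least three in the expansion in powers of the components $F_{\mu\nu}$. *)

(* Defs.v *)
From HB Require Import structures.
From mathcomp Require Import all_boot all_order all_algebra.
From mathcomp Require Import all_classical all_reals all_analysis.
Set Implicit Arguments.
Unset Strict Implicit.
Unset Printing Implicit Defensive.
Import Order.TTheory GRing.Theory Num.Theory.
Import numFieldNormedType.Exports.
Local Open Scope classical_set_scope.
Local Open Scope ring_scope.

Definition partial (R : realType) (mu : 'I_4) (f : 'rV[R]_4 -> R) :
  'rV[R]_4 -> R := fun u => 'D_(delta_mx 0 mu) f u.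

Fixpoint Ck (R : realType) (k : nat) (U : set 'rV[R]_4) (f : 'rV[R]_4 -> R) :
    Prop :=
  (forall u, U u -> {for u, continuous f}) /\
  if k is k'.+1 then
    forall mu, (forall u, U u -> derivable f u (delta_mx 0 mu)) /\
               Ck k' U (partial mu f)
  else True.

Definition smooth (R : realType) (U : set 'rV[R]_4) (f : 'rV[R]_4 -> R) : Prop :=
  forall k, Ck k U f.

(* Row mu is the tangent vector \partial_mu x of a parametrization x.         *)
Definition tangent (R : realType) (D : nat) (x : 'rV[R]_4 -> 'rV[R]_D)
    (u : 'rV[R]_4) : 'M[R]_(4, D) :=
  \matrix_(mu < 4, a < D) partial mu (fun v => x v 0 a) u.

(* An oriented embedded 4-manifold without boundary in R^D, given by a        *)
(* countable oriented atlas of local parametrizations x^a = chart i on the    *)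
(* open sets dom i (possibly empty, so finite atlases are included).          *)
(* At a common point of two charts both tangent matrices have the same row    *)
(* space and full rank, so there is exactly one T with                        *)
(* tangent (chart i) u = T *m tangent (chart j) v, namely the Jacobian of the *)
(* change of coordinates from chart i to chart j.                             *)
Record manifold4 (R : realType) (D : nat) := Manifold4 {
  carrier : set 'rV[R]_D ;
  dom : nat -> set 'rV[R]_4 ;
  chart : nat -> 'rV[R]_4 -> 'rV[R]_D ;
  dom_open : forall i, open (dom i) ;
  chart_smooth : forall i a, smooth (dom i) (fun u => chart i u 0 a) ;
  chart_inj : forall i u v,
    dom i u -> dom i v -> chart i u = chart i v -> u = v ;
  chart_immersion : forall i u, dom i u -> row_free (tangent (chart i) u) ;
  chart_cover : \bigcup_i (chart i @` dom i) = carrier ;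
  chart_open : forall i (V : set 'rV[R]_4), open V -> V `<=` dom i ->
    exists2 W : set 'rV[R]_D, open W & chart i @` V = carrier `&` W ;
  chart_oriented : forall i j u v (T : 'M[R]_4), dom i u -> dom j v ->
    chart i u = chart j v ->
    tangent (chart i) u = T *m tangent (chart j) v -> 0 < \det T
}.

Definition induced_metric (R : realType) (D : nat) (M : manifold4 R D) (i : nat)
    (u : 'rV[R]_4) : 'M[R]_4 :=
  \matrix_(mu, nu) \sum_(a < D)
    tangent (chart M i) u mu a * tangent (chart M i) u nu a.

Definition change_of_chart (R : realType) (D : nat) (M : manifold4 R D)
    (i j : nat) (u v : 'rV[R]_4) (T : 'M[R]_4) : Prop :=
  [/\ dom M i u, dom M j v, chart M i u = chart M j v &
      tangent (chart M i) u = T *m tangent (chart M j) v].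

(* Covariant tensor fields are families of components, one for each chart,    *)
(* related by the tensor transformation law.                                  *)
Definition one_form (R : realType) (D : nat) (M : manifold4 R D)
    (A : nat -> 'rV[R]_4 -> 'rV[R]_4) : Prop :=
  (forall i mu, smooth (dom M i) (fun u => A i u 0 mu)) /\
  (forall i j u v T, change_of_chart M i j u v T -> A i u = A j v *m T^T).

Definition two_form (R : realType) (D : nat) (M : manifold4 R D)
    (w : nat -> 'rV[R]_4 -> 'M[R]_4) : Prop :=
  [/\ forall i mu nu, smooth (dom M i) (fun u => w i u mu nu),
      forall i u, dom M i u -> (w i u)^T = - w i u &
      forall i j u v T, change_of_chart M i j u v T ->
        w i u = T *m w j v *m T^T].

Definition closed_form (R : realType) (D : nat) (M : manifold4 R D)
    (w : nat -> 'rV[R]_4 -> 'M[R]_4) : Prop :=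
  forall i u, dom M i u -> forall la mu nu,
    partial la (fun v => w i v mu nu) u + partial mu (fun v => w i v nu la) u
      + partial nu (fun v => w i v la mu) u = 0.

Definition nondegenerate_form (R : realType) (D : nat) (M : manifold4 R D)
    (w : nat -> 'rV[R]_4 -> 'M[R]_4) : Prop :=
  forall i u, dom M i u -> w i u \in unitmx.

Definition symplectic (R : realType) (D : nat) (M : manifold4 R D)
    (w : nat -> 'rV[R]_4 -> 'M[R]_4) : Prop :=
  [/\ two_form M w, closed_form M w & nondegenerate_form M w].

(* F_{mu nu} = \partial_mu A_nu - \partial_nu A_mu *)
Definition field_strength (R : realType) (A : nat -> 'rV[R]_4 -> 'rV[R]_4)
    (i : nat) (u : 'rV[R]_4) : 'M[R]_4 :=
  \matrix_(mu, nu) (partial mu (fun v => A i v 0 nu) u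
                    - partial nu (fun v => A i v 0 mu) u).

(* The rows are unit vectors, so the determinant is the sign of (i, j, k, l)  *)
(* if this is a permutation of (0, 1, 2, 3), and 0 otherwise.                 *)
Definition levi_civita (R : realType) (i j k l : 'I_4) : R :=
  \det (\matrix_(a < 4, b < 4) (tnth [tuple i; j; k; l] a == b)%:R).

Definition Pfaff (R : realType) (B : 'M[R]_4) : R :=
  8^-1 * \sum_mu \sum_nu \sum_rho \sum_kappa
    levi_civita R mu nu rho kappa * B mu nu * B rho kappa.

(* (star_g w)_{mu nu}
     = 1/2 sqrt(det g) eps_{mu nu rho kappa} g^{rho al} g^{kappa be} w_{al be} *)
Definition hodge (R : realType) (g w : 'M[R]_4) : 'M[R]_4 :=
  \matrix_(mu, nu) (2^-1 * Num.sqrt (\det g) *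
    \sum_rho \sum_kappa \sum_al \sum_be
      levi_civita R mu nu rho kappa * invmx g rho al * invmx g kappa be
        * w al be).

(* a_{mu nu} b_{mu' nu'} g^{mu mu'} g^{nu nu'} *)
Definition contract_form (R : realType) (g a b : 'M[R]_4) : R :=
  \sum_mu \sum_nu \sum_mu' \sum_nu'
    a mu nu * b mu' nu' * invmx g mu mu' * invmx g nu nu'.

(* In the following tinv is the matrix theta^{-1}_{mu nu}, so that            *)
(* theta^{mu nu} is invmx tinv. The product theta g theta^T has the entries   *)
(* theta^{mu rho} theta^{nu kappa} g_{rho kappa}, and the first equation says *)
(* that e^{-sigma} theta g theta^T is the inverse matrix of G_{mu nu}.        *)
Definition effective_eqs (R : realType) (g tinv G : 'M[R]_4) (sigma : R) :
    Prop :=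
  G *m (expR (- sigma) *: (invmx tinv *m g *m (invmx tinv)^T)) = 1%:M /\
  expR (- sigma) = Num.sqrt (\det tinv) / Num.sqrt (\det G).

(* The unique solution of these equations (if g is positive definite and tinv *)
(* is antisymmetric and invertible), with a junk value if there is none.      *)
Definition effective (R : realType) (g tinv : 'M[R]_4) : 'M[R]_4 * R :=
  xget (0, 0) [set Gs | effective_eqs g tinv Gs.1 Gs.2].

Definition effective_metric (R : realType) (g tinv : 'M[R]_4) : 'M[R]_4 :=
  (effective g tinv).1.

Definition effective_sigma (R : realType) (g tinv : 'M[R]_4) : R :=
  (effective g tinv).2.

Definition effective_eta (R : realType) (g tinv : 'M[R]_4) : R :=
  4^-1 * expR (effective_sigma g tinv) *
    \sum_mu \sum_nu invmx (effective_metric g tinv) mu nu * g mu nu.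

(* The unique s with tb g tb g = - e^s, where tb is the inverse of wb, and a  *)
(* junk value if there is none.                                               *)
Definition background_sigma (R : realType) (g wb : 'M[R]_4) : R :=
  xget 0 [set s | invmx wb *m g *m invmx wb *m g = - expR s *: 1%:M].

Definition leb4 (R : realType) :=
  (((@lebesgue_measure R \x @lebesgue_measure R) \x @lebesgue_measure R)
    \x @lebesgue_measure R)%E.

Definition vec4 (R : realType) (p : R * R * R * R) : 'rV[R]_4 :=
  \row_j tnth [tuple p.1.1.1; p.1.1.2; p.1.2; p.2] j.

(* The part of the i-th chart not covered by the previous ones: the images of *)
(* these Borel sets form a partition of M.                                    *)
Definition piece (R : realType) (D : nat) (M : manifold4 R D) (i : nat) :
    set (R * R * R * R) :=
  [set p | dom M i (vec4 p) /\
     forall j, (j < i)%N -> ~ (chart M j @` dom M j) (chart M i (vec4 p))].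

(* \int_M d^4x / (2 pi)^2 sqrt|g| f, for a scalar f given in each chart; as   *)
(* for any Lebesgue integral, positive and negative parts are integrated      *)
(* separately.                                                                *)
Definition integral_M (R : realType) (D : nat) (M : manifold4 R D)
    (f : nat -> 'rV[R]_4 -> R) : \bar R :=
  let dens i p :=
    (((2 * pi) ^+ 2)^-1 * Num.sqrt `|\det (induced_metric M i (vec4 p))|
      * f i (vec4 p))%:E in
  (\sum_(0 <= i <oo) \int[@leb4 R]_(p in piece M i) (dens i)^\+ p
   - \sum_(0 <= i <oo) \int[@leb4 R]_(p in piece M i) (dens i)^\- p)%E.

Definition YM_lagrangian (R : realType) (g tinv : 'M[R]_4) : R :=
  expR (- effective_sigma g tinv) * effective_eta g tinv.

Definition S_YM (R : realType) (D : nat) (M : manifold4 R D)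
    (tinv : nat -> 'rV[R]_4 -> 'M[R]_4) : \bar R :=
  integral_M M (fun i u => YM_lagrangian (induced_metric M i u) (tinv i u)).

(* The homogeneous part of degree n of a power series in the components of F: *)
(* a word of index pairs stands for the product of the corresponding F_{mu nu}. *)
Definition homogeneous_part (R : realType) (c : seq ('I_4 * 'I_4) -> R)
    (F : 'M[R]_4) (n : nat) : R :=
  \sum_(w : n.-tuple ('I_4 * 'I_4)) c w * \prod_(p <- w) F p.1 p.2.

(* r i u F, as a function of an antisymmetric matrix F near 0, is the sum of  *)
(* an absolutely convergent power series in the components F_{mu nu} all of   *)
(* whose terms have order at least three. The coefficients depend on the      *)
(* point, the radius and the bound being locally uniform.                     *)
Definition O_F3 (R : realType) (D : nat) (M : manifold4 R D)
    (r : nat -> 'rV[R]_4 -> 'M[R]_4 -> R) : Prop :=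
  forall i u, dom M i u ->
  exists (c : 'rV[R]_4 -> seq ('I_4 * 'I_4) -> R) (delta C : R),
    0 < delta /\
    \forall v \near u,
      [/\ forall w, (size w < 3)%N -> c v w = 0,
          forall n, \sum_(k < n) (\sum_(w : k.-tuple ('I_4 * 'I_4)) `|c v w|)
                      * delta ^+ k <= C &
          forall F : 'M[R]_4, F^T = - F ->
            (forall mu nu, `|F mu nu| <= delta) ->
            series (homogeneous_part (c v) F) @ \oo --> r i v F].

(* Main.v *)
Require Import Defs.
From HB Require Import structures.
From mathcomp Require Import all_boot all_order all_algebra ring lra.
From mathcomp Require Import all_classical all_reals all_analysis.
Set Implicit Arguments.
Unset Strict Implicit.
Unset Printing Implicit Defensive.
Import Order.TTheory GRing.Theory Num.Theory.
Import numFieldNormedType.Exports.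
Local Open Scope classical_set_scope.
Local Open Scope ring_scope.

(** The Lagrangian is e^{-sigma} eta = sqrt(det g) <w, w> / (4 |Pf w|) for
    w = theta^{-1}, where <w, w> = w_{mn} w_{m'n'} g^{mm'} g^{nn'}.  If wb is
    (anti-)self-dual, then <wb, F> is a multiple of the polarization of Pf, and
    for w = wb + F the constant and linear parts of sqrt(det g) <w, w> / 4 and
    of |Pf w| agree; hence e^{-sigma} eta = 1 + Q(F) / Pf(wb + F) with
    Q(F) = +- sqrt(det g) <F, F> / 4 - Pf F.  This gives the second and the
    third form, with remainder Q(F) (1 / Pf(wb + F) - 1 / Pf wb).  For the
    first form, X = G g^{-1} satisfies X + X^{-1} = 2 e^{-sigma} eta, so that
    h_{mn} h^{mn} / 8 = L^2 - L for L = e^{-sigma} eta, with remainder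
    - (L - 1)^2.  Both remainders are rational in F with the denominator
    Pf(wb + F), a polynomial of degree two with nonzero constant term, and their
    power series are found by solving for the coefficients recursively. *)

(** * Skew-symmetric 4x4 matrices *)

(* Indexing by nat lets the entries at numerals compute. *)
Definition mx4 (R : Type) (f : nat -> nat -> R) : 'M[R]_4 := \matrix_(i, j) f i j.

Lemma mx4E (R : Type) (A : 'M[R]_4) :
  A = mx4 (fun i j => A (inord i) (inord j)).
Proof. by apply/matrixP => i j; rewrite mxE !inord_val. Qed.

Lemma eq_mx4 (R : Type) (f g : nat -> nat -> R) :
  (forall i j, (i < 4)%N -> (j < 4)%N -> f i j = g i j) -> mx4 f = mx4 g.
Proof. by move=> fg; apply/matrixP => i j; rewrite !mxE fg. Qed.

Lemma mul_mx4 (R : pzRingType) (f g : nat -> nat -> R) :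
  mx4 f *m mx4 g =
  mx4 (fun i j => f i 0 * g 0 j + f i 1 * g 1 j + f i 2 * g 2 j + f i 3 * g 3 j).
Proof.
by apply/matrixP => i j; rewrite !mxE !big_ord_recr big_ord0 /= !mxE add0r.
Qed.

Lemma tr_mx4 (R : Type) (f : nat -> nat -> R) : (mx4 f)^T = mx4 (fun i j => f j i).
Proof. by apply/matrixP => i j; rewrite !mxE. Qed.

Lemma mxtrace_mx4 (R : pzRingType) (f : nat -> nat -> R) :
  \tr (mx4 f) = f 0 0 + f 1 1 + f 2 2 + f 3 3.
Proof. by rewrite /mxtrace !big_ord_recr big_ord0 /= !mxE add0r. Qed.

(** Laplace expansion along the first row. Since [bump k] skips column [k] at the level of natural
    numbers, the minors have the same shape again and the expansion can be iterated. *)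
Lemma det_matrix_rec (R : comPzRingType) n (f : nat -> nat -> R) :
  \det (\matrix_(i < n.+1, j < n.+1) f i j) =
  \sum_(k < n.+1) (-1) ^+ k * f 0 k *
    \det (\matrix_(i < n, j < n) f i.+1 (bump k j)).
Proof.
rewrite (expand_det_row _ ord0); apply: eq_bigr => k _.
rewrite mxE /cofactor add0n mulrA [f _ _ * _]mulrC; congr (_ * \det _).
by apply/matrixP => i j; rewrite !mxE.
Qed.

Lemma det_matrix2 (R : comPzRingType) (f : nat -> nat -> R) :
  \det (\matrix_(i < 2, j < 2) f i j) = f 0 0 * f 1 1 - f 0 1 * f 1 0.
Proof.
rewrite det_matrix_rec !big_ord_recr big_ord0 !det_mx11 !mxE /=.
rewrite /bump /= !addn0 expr1 expr0; ring.
Qed.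

Lemma det_matrix3 (R : comPzRingType) (f : nat -> nat -> R) :
  \det (\matrix_(i < 3, j < 3) f i j) =
  f 0 0 * (f 1 1 * f 2 2 - f 1 2 * f 2 1)
  - f 0 1 * (f 1 0 * f 2 2 - f 1 2 * f 2 0)
  + f 0 2 * (f 1 0 * f 2 1 - f 1 1 * f 2 0).
Proof.
rewrite det_matrix_rec !big_ord_recr big_ord0 /=.
rewrite !(det_matrix2 (fun i j => f i.+1 (bump _ j))) /bump /=.
rewrite !(add0n, addn0, add1n) !exprS expr0; ring.
Qed.

Lemma det_mx4 (R : comPzRingType) (f : nat -> nat -> R) :
  \det (mx4 f) =
    (f 0 0 * f 1 1 - f 0 1 * f 1 0) * (f 2 2 * f 3 3 - f 2 3 * f 3 2)
  - (f 0 0 * f 1 2 - f 0 2 * f 1 0) * (f 2 1 * f 3 3 - f 2 3 * f 3 1)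
  + (f 0 0 * f 1 3 - f 0 3 * f 1 0) * (f 2 1 * f 3 2 - f 2 2 * f 3 1)
  + (f 0 1 * f 1 2 - f 0 2 * f 1 1) * (f 2 0 * f 3 3 - f 2 3 * f 3 0)
  - (f 0 1 * f 1 3 - f 0 3 * f 1 1) * (f 2 0 * f 3 2 - f 2 2 * f 3 0)
  + (f 0 2 * f 1 3 - f 0 3 * f 1 2) * (f 2 0 * f 3 1 - f 2 1 * f 3 0).
Proof.
rewrite /mx4 det_matrix_rec !big_ord_recr big_ord0 /=.
rewrite !(det_matrix3 (fun i j => f i.+1 (bump _ j))) /bump /=.
rewrite !(add0n, addn0, add1n) !exprS expr0; ring.
Qed.

Definition skew4 (R : pzRingType) (a b c d e f : R) : 'M[R]_4 :=
  mx4 (fun i j => nth 0 (nth [::]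
    [:: [:: 0; a; b; c]; [:: - a; 0; d; e]; [:: - b; - d; 0; f];
        [:: - c; - e; - f; 0]] i) j).

(* dual w is the matrix 1/2 eps_{mnrk} w_{rk}, and pf2 is the symmetric bilinear
   form with pf2 w w = Pf w, for skew-symmetric matrices only. *)
Definition dual (R : pzRingType) (w : 'M[R]_4) : 'M[R]_4 :=
  let x i j := w (inord i) (inord j) in
  skew4 (x 2 3) (- x 1 3) (x 1 2) (x 0 3) (- x 0 2) (x 0 1).

Definition pf2 (R : unitRingType) (v w : 'M[R]_4) : R :=
  let x i j := v (inord i) (inord j) in let y i j := w (inord i) (inord j) in
  2^-1 * (x 0 1 * y 2 3 - x 0 2 * y 1 3 + x 0 3 * y 1 2
          + x 1 2 * y 0 3 - x 1 3 * y 0 2 + x 2 3 * y 0 1).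

Section Skew.
Variable R : numFieldType.
Implicit Types (w v A g : 'M[R]_4).

Lemma skewE w : w^T = - w -> let x i j := w (inord i) (inord j) in
  w = skew4 (x 0 1) (x 0 2) (x 0 3) (x 1 2) (x 1 3) (x 2 3).
Proof.
move=> /matrixP skw x.
have xN i j : x i j = - x j i by have := skw (inord j) (inord i); rewrite !mxE.
have x0 i : x i i = 0.
  have /eqP := xN i i; rewrite -addr_eq0 -mulr2n mulrn_eq0 /= => /eqP //.
rewrite [LHS]mx4E; apply: eq_mx4 => i j.
by move: i j => [|[|[|[|i]]]] [|[|[|[|j]]]] //= _ _;
  rewrite -/(x _ _) ?x0 // xN.
Qed.

Lemma dual_skew4 (a b c d e f : R) :
  dual (skew4 a b c d e f) = skew4 f (- e) d c (- b) a.
Proof. by rewrite /dual !mxE !inordK. Qed.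

Lemma pf2_skew4 (a b c d e f a' b' c' d' e' f' : R) :
  pf2 (skew4 a b c d e f) (skew4 a' b' c' d' e' f') =
  2^-1 * (a * f' - b * e' + c * d' + d * c' - e * b' + f * a').
Proof. by rewrite /pf2 !mxE !inordK. Qed.

Lemma skew4T (a b c d e f : R) : (skew4 a b c d e f)^T = - skew4 a b c d e f.
Proof.
rewrite /skew4 tr_mx4; apply/matrixP => i j; rewrite !mxE.
by case: i j => [[|[|[|[|i]]]] ?] [[|[|[|[|j]]]] ?] //=; rewrite ?opprK ?oppr0.
Qed.

Lemma dualT w : (dual w)^T = - dual w.
Proof. exact: skew4T. Qed.

Lemma dualK w : w^T = - w -> dual (dual w) = w.
Proof. by move/skewE ->; rewrite !dual_skew4 !opprK. Qed.

Lemma add_mx4 (f h : nat -> nat -> R) :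
  mx4 f + mx4 h = mx4 (fun i j => f i j + h i j).
Proof. by apply/matrixP => i j; rewrite !mxE. Qed.

Lemma scale_mx4 a (f : nat -> nat -> R) : a *: mx4 f = mx4 (fun i j => a * f i j).
Proof. by apply/matrixP => i j; rewrite !mxE. Qed.

Lemma scalar_mx4 (a : R) : a%:M = mx4 (fun i j => a *+ (i == j)).
Proof. by apply/matrixP => i j; rewrite !mxE. Qed.

(** Polarization of the identity that [w] times [dual w] is the scalar - Pf w. It makes [dual w] a
    multiple of the inverse of [w], and all inverses below come from it. *)
Lemma mul_dual v w : v^T = - v -> w^T = - w ->
  v *m dual w + w *m dual v = (- 2 * pf2 v w)%:M.
Proof.
move=> /skewE -> /skewE ->; rewrite !dual_skew4 pf2_skew4 /skew4.
rewrite !mul_mx4 add_mx4 scalar_mx4; apply: eq_mx4.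
by move=> [|[|[|[|i]]]] [|[|[|[|j]]]] //= _ _; field.
Qed.

Lemma mxtrace_dual v w : v^T = - v -> w^T = - w ->
  \tr (dual v *m dual w) = \tr (v *m w).
Proof.
move=> /skewE -> /skewE ->; rewrite !dual_skew4 /skew4 !mul_mx4 !mxtrace_mx4 /=.
ring.
Qed.

Lemma mxtrace_mul_dual v w : v^T = - v -> w^T = - w ->
  \tr (v *m dual w) = - 4 * pf2 v w.
Proof.
move=> /skewE -> /skewE ->; rewrite !dual_skew4 pf2_skew4 /skew4 !mul_mx4.
by rewrite mxtrace_mx4 /=; field.
Qed.

Lemma pf2_dual w : w^T = - w -> pf2 (dual w) (dual w) = pf2 w w.
Proof. by move/skewE ->; rewrite dual_skew4 !pf2_skew4; ring. Qed.

Lemma pf2Z (c : R) w : pf2 (c *: w) (c *: w) = c ^+ 2 * pf2 w w.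
Proof. by rewrite /pf2 !mxE; ring. Qed.

Lemma pf2_sum v w :
  pf2 (v + w) (v + w) = pf2 v v + 2 * pf2 w v + pf2 w w.
Proof. by rewrite /pf2 !mxE; field. Qed.

Lemma det_skew w : w^T = - w -> \det w = pf2 w w ^+ 2.
Proof. by move=> /skewE ->; rewrite pf2_skew4 /skew4 det_mx4 /=; field. Qed.

Lemma congr_skew4 (x : nat -> nat -> R) (a b c d e f : R) :
  let y i j := a * (x i 0 * x j 1 - x i 1 * x j 0)
             + b * (x i 0 * x j 2 - x i 2 * x j 0)
             + c * (x i 0 * x j 3 - x i 3 * x j 0)
             + d * (x i 1 * x j 2 - x i 2 * x j 1)
             + e * (x i 1 * x j 3 - x i 3 * x j 1)
             + f * (x i 2 * x j 3 - x i 3 * x j 2) in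
  mx4 x *m skew4 a b c d e f *m (mx4 x)^T =
  skew4 (y 0 1) (y 0 2) (y 0 3) (y 1 2) (y 1 3) (y 2 3).
Proof.
rewrite /= tr_mx4 /skew4 !mul_mx4; apply: eq_mx4.
by move=> [|[|[|[|i]]]] [|[|[|[|j]]]] //= _ _; ring.
Qed.

(** The Levi-Civita symbol is invariant under a change of basis up to the determinant, so [dual]
    turns a 2-form into a bivector density. *)
Lemma dual_congr A w : w^T = - w ->
  A^T *m dual (A *m w *m A^T) *m A = \det A *: dual w.
Proof.
move=> /skewE ->; rewrite (mx4E A); move: (fun i j => A _ _) => x.
rewrite congr_skew4 !dual_skew4 -[in X in _ *m X](trmxK (mx4 x)) tr_mx4.
rewrite congr_skew4 det_mx4 /skew4 scale_mx4.
(* With the entries generalized to variables, what remains is a polynomial identity for each of the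
   sixteen positions. *)
move: (x 0 0) (x 0 1) (x 0 2) (x 0 3) (x 1 0) (x 1 1) (x 1 2) (x 1 3) (x 2 0)
  (x 2 1) (x 2 2) (x 2 3) (x 3 0) (x 3 1) (x 3 2) (x 3 3).
move: (w _ _) (w _ _) (w _ _) (w _ _) (w _ _) (w _ _).
move=> *; apply: eq_mx4.
by move=> [|[|[|[|i]]]] [|[|[|[|j]]]] //= _ _; ring.
Qed.
End Skew.

(** * The Lagrangian in terms of Pfaffians *)

Section LeviCivita.
Variable R : realType.
Implicit Types (w v A g : 'M[R]_4).

Lemma levi_civita_sum (i j : 'I_4) w : w^T = - w ->
  \sum_k \sum_l levi_civita R i j k l * w k l = 2 * dual w i j.
Proof.
(* The same symbol with indices in [nat]: its determinants compute once the indices are numerals. *)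
pose e (i j k l : nat) : R :=
  \det (mx4 (fun a b => (nth 0%N [:: i; j; k; l] a == b)%:R)).
have lcE (k l : 'I_4) : levi_civita R i j k l = e i j k l.
  congr (\det _); apply/matrixP => a b; rewrite !mxE.
  by case: a => [[|[|[|[|a]]]] ?].
under eq_bigr do under eq_bigr do rewrite lcE.
move/skewE ->; rewrite dual_skew4.
move: (w _ _) (w _ _) (w _ _) (w _ _) (w _ _) (w _ _) => x1 x2 x3 x4 x5 x6.
rewrite !big_ord_recr !big_ord0 /= !mxE /= /e !det_mx4.
case: i j {lcE} => [[|[|[|[|i]]]] ?] [[|[|[|[|j]]]] ?] //=.
all: ring.
Qed.

Lemma levi_civita_pf2 v w : v^T = - v -> w^T = - w ->
  \sum_i \sum_j \sum_k \sum_l levi_civita R i j k l * v i j * w k l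
  = 8 * pf2 v w.
Proof.
move=> skv skw.
have -> : 8 * pf2 v w = - (2 * \tr (v *m dual w)) by rewrite mxtrace_mul_dual //; ring.
rewrite -mulrN -linearN -mulNmx -skv mulr_sumr exchange_big /=.
apply: eq_bigr => j _; rewrite mxE mulr_sumr; apply: eq_bigr => i _.
rewrite mxE mulrCA -levi_civita_sum // mulr_sumr; apply: eq_bigr => k _.
by rewrite mulr_sumr; apply: eq_bigr => l _; rewrite mulrAC mulrC.
Qed.

Lemma Pfaff_skew w : w^T = - w -> Pfaff w = pf2 w w.
Proof.
by move=> skw; rewrite /Pfaff levi_civita_pf2 // mulrA mulVf ?mul1r // pnatr_eq0.
Qed.

(** Index contractions become traces, where cyclicity and the matrix identities for [dual] apply. *)
Lemma contract_formE g a b :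
  contract_form g a b = \tr (a^T *m invmx g *m b *m (invmx g)^T).
Proof.
rewrite /contract_form exchange_big /=; apply: eq_bigr => n _.
rewrite mxE [RHS](eq_bigr (fun j => \sum_i \sum_k
  (a k n * invmx g k i * b i j * invmx g n j))); last first.
  move=> j _; rewrite !mxE mulr_suml; apply: eq_bigr => i _.
  by rewrite !mxE !mulr_suml; apply: eq_bigr => k _; rewrite !mxE.
under [RHS]eq_bigr do rewrite exchange_big /=.
rewrite [RHS]exchange_big; apply: eq_bigr => m _ /=.
rewrite [RHS]exchange_big; apply: eq_bigr => m' _ /=.
by apply: eq_bigr => n' _; ring.
Qed.

End LeviCivita.

(** * The Hodge star and the effective metric *)

Section Metric.
Variable R : realType.
Variable g : 'M[R]_4.
Hypothesis gT : g^T = g.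
Hypothesis g_gt0 : 0 < \det g.
Implicit Types (w v : 'M[R]_4).
Let gi := invmx g.
Let q := Num.sqrt (\det g).

Let gU : g \in unitmx. Proof. by rewrite unitmxE unitfE gt_eqF. Qed.
Let giT : gi^T = gi. Proof. by rewrite trmx_inv gT. Qed.
Let giS i j : gi i j = gi j i. Proof. by rewrite -[in LHS]giT mxE. Qed.
Let g_neq0 : \det g != 0. Proof. by rewrite gt_eqF. Qed.
Let q_gt0 : 0 < q. Proof. by rewrite sqrtr_gt0. Qed.
Let qq : q ^+ 2 = \det g. Proof. by rewrite sqr_sqrtr // ltW. Qed.

Lemma mxtraceN n (A : 'M[R]_n) : \tr (- A) = - \tr A.
Proof. exact: raddfN. Qed.

Lemma dual_metric w : w^T = - w ->
  g *m dual w *m g = \det g *: dual (gi *m w *m gi).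
Proof.
move=> skw; have := dual_congr gi skw; rewrite giT det_inv => E.
have -> : dual w = \det g *: (gi *m dual (gi *m w *m gi) *m gi).
  by rewrite E scalerA divff // scale1r.
by rewrite -scalemxAr -scalemxAl !mulmxA mulmxV // mul1mx mulmxKV.
Qed.

Lemma raised_skew w : w^T = - w -> (gi *m w *m gi)^T = - (gi *m w *m gi).
Proof. by move=> skw; rewrite !trmx_mul giT skw mulNmx mulmxN mulmxA. Qed.

(** In view of [hodge_dual], this says that the Hodge star is an isometry on 2-forms. *)
Lemma mxtrace_dual_metric w v : w^T = - w -> v^T = - v ->
  \tr (g *m dual w *m g *m dual v) = \det g * \tr (w *m gi *m v *m gi).
Proof.
move=> skw skv; rewrite dual_metric // -scalemxAl linearZ /=.
rewrite mxtrace_dual ?raised_skew //.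
by rewrite -!mulmxA mxtrace_mulC !mulmxA.
Qed.

Lemma mulmx_dual w : w^T = - w -> w *m dual w = (- pf2 w w)%:M.
Proof.
move=> skw; apply: (@scalerI _ _ (2 : R)); first by rewrite pnatr_eq0.
by rewrite scale_scalar_mx mulrN -mulNr -(mul_dual skw skw) scaler_nat mulr2n.
Qed.

Lemma dual_mulmx w : w^T = - w -> dual w *m w = (- pf2 w w)%:M.
Proof.
move=> skw; have := mulmx_dual skw => /(congr1 trmx).
by rewrite trmx_mul dualT skw mulNmx mulmxN opprK tr_scalar_mx.
Qed.

Lemma skew_unit w : w^T = - w -> (w \in unitmx) = (pf2 w w != 0).
Proof. by move=> skw; rewrite unitmxE unitfE det_skew // expf_eq0. Qed.

Lemma invmx_skew w : w^T = - w -> pf2 w w != 0 ->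
  invmx w = - (pf2 w w)^-1 *: dual w.
Proof.
move=> skw P0; have wU : w \in unitmx by rewrite skew_unit.
rewrite -[RHS]mul1mx -(mulVmx wU) -mulmxA -scalemxAr mulmx_dual //.
by rewrite scale_scalar_mx mulrNN mulVf // mulmx1.
Qed.

(* With Z = (w g^{-1})^2, the scalar matrix w (dual v) + v (dual w) for
   v = dual (g^{-1} w g^{-1}) is Z + (Pf w)^2 / det g * Z^{-1}. *)
Lemma metric_square w : w^T = - w -> let Z := w *m gi *m w *m gi in
  Z *m Z = (2^-1 * \tr Z) *: Z - (pf2 w w ^+ 2 / \det g)%:M.
Proof.
move=> skw Z; set V := g *m dual w *m g *m dual w.
have E : Z + (\det g)^-1 *: V = (2^-1 * \tr Z)%:M.
  have skv := raised_skew skw; have := mul_dual skw (dualT (gi *m w *m gi)).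
  rewrite dualK // !mulmxA -/Z => E0.
  have Vdef : dual (gi *m w *m gi) *m dual w = (\det g)^-1 *: V.
    by rewrite /V dual_metric // -scalemxAl scalerA mulVf // scale1r.
  move: E0; rewrite Vdef => E0; rewrite E0; congr _%:M.
  move/(congr1 mxtrace): E0; rewrite linearD linearZ /= mxtrace_dual_metric //.
  rewrite -/Z mulrA mulVf // mul1r mxtrace_scalar; lra.
have ZV : Z *m V = (pf2 w w ^+ 2)%:M.
  rewrite /Z /V !mulmxA mulmxKV // -(mulmxA _ w (dual w)) mulmx_dual //.
  rewrite mul_mx_scalar -!scalemxAl mulmxKV // mulmx_dual //.
  by rewrite scale_scalar_mx mulrNN.
have -> : Z *m Z = Z *m (Z + (\det g)^-1 *: V) - (\det g)^-1 *: (Z *m V).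
  by rewrite mulmxDr -scalemxAr addrK.
by rewrite E ZV mul_mx_scalar scale_scalar_mx (mulrC _ (_ ^+ 2)).
Qed.

Lemma hodge_dual w : w^T = - w -> hodge g w = q^-1 *: (g *m dual w *m g).
Proof.
move=> skw; have qV : q^-1 * \det g = q.
  by rewrite -qq expr2 mulKf // gt_eqF.
rewrite dual_metric // scalerA qV; apply/matrixP => i j; rewrite [LHS]mxE [RHS]mxE -/q.
rewrite -[dual _ i j](@mulKf _ 2) ?pnatr_eq0 //.
rewrite -(levi_civita_sum i j (raised_skew skw)).
rewrite mulrCA mulrA; congr (_ * _).
apply: eq_bigr => k _; apply: eq_bigr => l _.
rewrite !mxE mulr_sumr exchange_big; apply: eq_bigr => b _ /=.
rewrite !mxE mulr_suml mulr_sumr; apply: eq_bigr => a _.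
by rewrite -/gi (giS b l); ring.
Qed.

(** Solves the first equation of [effective_eqs] for the metric when [t] is the value of e^{-sigma};
    the minus sign comes from the transpose of [w]. *)
Lemma inv_effective_metric w t : w^T = - w -> pf2 w w != 0 -> t != 0 ->
  (- t^-1 *: (w *m gi *m w)) *m (t *: (invmx w *m g *m (invmx w)^T)) = 1%:M.
Proof.
move=> skw P0 t0; have wU : w \in unitmx by rewrite skew_unit.
rewrite -scalemxAl -scalemxAr scalerA mulNr mulVf // scaleN1r trmx_inv skw.
have -> : invmx (- w) = - invmx w.
  have wNU : - w \in unitmx by rewrite -skw unitmx_tr.
  apply: (can_inj (mulKmx wU)); rewrite mulmxN mulmxV //.
  by apply: oppr_inj; rewrite opprK -mulNmx mulmxV.
by rewrite !mulmxN opprK !mulmxA mulmxK // mulmxKV // mulmxV.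
Qed.

Lemma effective_exists w : w^T = - w -> pf2 w w != 0 ->
  effective_eqs g w (- (q / `|pf2 w w|) *: (w *m gi *m w))
    (- ln (`|pf2 w w| / q)).
Proof.
move=> skw P0; have a0 : 0 < `|pf2 w w| by rewrite normr_gt0.
have t0 : 0 < `|pf2 w w| / q by rewrite divr_gt0.
rewrite /effective_eqs opprK lnK ?posrE //; split.
  by have := inv_effective_metric skw P0 (lt0r_neq0 t0); rewrite invf_div.
(* In dimension 4 the scalar factor enters the determinant to the fourth power, which cancels the
   Pfaffians and leaves det G = det g. *)
rewrite detZ !det_mulmx det_inv -/gi (det_skew skw) sqrtr_sqr.
congr (_ / _); rewrite -[LHS]gtr0_norm // -sqrtr_sqr; congr Num.sqrt.
rewrite -normr_eq0 in P0; rewrite -[pf2 w w ^+ 2]real_normK ?num_real // -qq.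
by field; rewrite P0 gt_eqF.
Qed.

(** The determinant of the first equation, combined with the second, forces det G = det g. This
    fixes e^{-sigma}, and then G as an inverse matrix. *)
Lemma effective_unique w G sigma : w^T = - w -> pf2 w w != 0 ->
  effective_eqs g w G sigma ->
  expR (- sigma) = `|pf2 w w| / q /\
  G = - (q / `|pf2 w w|) *: (w *m gi *m w).
Proof.
move=> skw P0; rewrite /effective_eqs.
move: (expR (- sigma)) (expR_gt0 (- sigma)) => t t_gt0 [GK].
have wU : w \in unitmx by rewrite skew_unit.
rewrite det_skew // sqrtr_sqr => tE.
(* [Num.sqrt] is 0 on non-positive numbers and the inverse of 0 is 0, so a non-positive determinant
   would give [t] = 0. *)
have G_gt0 : 0 < \det G.
  rewrite ltNge; apply/negP => /ler0_sqrtr G0; move: t_gt0.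
  by rewrite tE G0 invr0 mulr0 ltxx.
have d_gt0 : 0 < Num.sqrt (\det G) by rewrite sqrtr_gt0.
have detE : Num.sqrt (\det G) = q.
  have := congr1 determinant GK.
  rewrite det1 det_mulmx detZ !det_mulmx det_tr det_inv (det_skew skw) tE -qq.
  have := sqr_sqrtr (ltW G_gt0).
  move: P0; rewrite -normr_eq0 => P0.
  rewrite -[pf2 w w ^+ 2]real_normK ?num_real //.
  move: d_gt0; move: (Num.sqrt (\det G)) => d d_gt0 <- E.
  suff : q ^+ 2 = d ^+ 2 by move/eqP; rewrite eqrXn2 ?ltW // => /eqP ->.
  have d0 : d != 0 by rewrite gt_eqF.
  rewrite -[RHS]mulr1 -[in RHS]E; field.
  by rewrite P0 d0.
rewrite tE detE in GK *; split=> //.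
have t0 : `|pf2 w w| / q != 0 by rewrite -detE -tE gt_eqF.
have := mulmx1C (inv_effective_metric skw P0 t0); rewrite invf_div => KX.
by rewrite -[LHS]mulmx1 -KX mulmxA GK mul1mx.
Qed.

Lemma effectiveE w : w^T = - w -> pf2 w w != 0 ->
  expR (- effective_sigma g w) = `|pf2 w w| / q /\
  effective_metric g w = - (q / `|pf2 w w|) *: (w *m gi *m w).
Proof.
move=> skw P0; rewrite /effective_sigma /effective_metric /effective.
apply: effective_unique => //.
pose Gs := (- (q / `|pf2 w w|) *: (w *m gi *m w), - ln (`|pf2 w w| / q)).
exact: (@xgetPex _ (0, 0) [set Gs | effective_eqs g w Gs.1 Gs.2]
  (ex_intro _ Gs (effective_exists skw P0))).
Qed.

Lemma mxtrace_tr_mul n (A B : 'M[R]_n) :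
  \sum_i \sum_j A i j * B i j = \tr (A^T *m B).
Proof.
rewrite exchange_big; apply: eq_bigr => j _.
by rewrite mxE; apply: eq_bigr => i _; rewrite mxE.
Qed.

(** The exponentials cancel and leave a quarter of the trace of G^{-1} g. Writing the inverse of [w]
    through [dual w] and applying the isometry property brings the trace back to [w] itself. *)
Lemma YM_lagrangianE w : w^T = - w -> pf2 w w != 0 ->
  YM_lagrangian g w = - (q * \tr (w *m gi *m w *m gi)) / (4 * `|pf2 w w|).
Proof.
move=> skw P0; have [tE GE] := effectiveE skw P0.
rewrite /YM_lagrangian /effective_eta mxtrace_tr_mul.
have -> : expR (effective_sigma g w) = (expR (- effective_sigma g w))^-1.
  by rewrite -expRN opprK.
move: (expR _) (expR_gt0 (- effective_sigma g w)) tE => t t_gt0 tE.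
have t0 : t != 0 by rewrite gt_eqF.
have wU : w \in unitmx by rewrite skew_unit.
have GK : effective_metric g w *m (t *: (invmx w *m g *m (invmx w)^T)) = 1%:M.
  by have := inv_effective_metric skw P0 t0; rewrite tE invf_div -GE.
have -> : invmx (effective_metric g w) = t *: (invmx w *m g *m (invmx w)^T).
  have [GU _] := mulmx1_unit GK.
  by rewrite -[LHS]mulmx1 -GK mulKmx.
have -> : invmx w *m g *m (invmx w)^T =
    - pf2 w w ^- 2 *: (dual w *m g *m dual w).
  rewrite invmx_skew // linearZ /= dualT -!scalemxAl -scalemxAr scalerA mulrNN.
  rewrite mulmxN scalerN scaleNr; congr (- (_ *: _)).
  by rewrite -exprVn expr2.
rewrite scalerA linearZ /= -scalemxAl linearZ /= !trmx_mul dualT gT.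
rewrite mulNmx !mulmxN opprK mxtrace_mulC !mulmxA.
rewrite mxtrace_dual_metric // tE -qq.
rewrite -[pf2 w w ^+ 2]real_normK ?num_real //.
rewrite -/gi; move: P0; rewrite -normr_eq0 => P0.
by field; rewrite P0 gt_eqF.
Qed.

Lemma contract_skew v w : v^T = - v ->
  contract_form g v w = - \tr (v *m gi *m w *m gi).
Proof. by move=> skv; rewrite contract_formE skv giT !mulNmx linearN. Qed.

(** With X = G g^{-1} = c Z and L the Lagrangian, [metric_square] reads X^2 = 2 L X - 1, and tr X =
    4 L. Hence tr (X - 1)^2 = 8 L^2 - 8 L. *)
Lemma contract_effective_sub w : w^T = - w -> pf2 w w != 0 ->
  let h := effective_metric g w - g in
  contract_form g h h =
  8 * (YM_lagrangian g w ^+ 2 - YM_lagrangian g w).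
Proof.
move=> skw P0 h; have [_ GE] := effectiveE skw P0.
have hT : h^T = h.
  rewrite /h GE linearB linearZ /= gT !trmx_mul giT skw.
  by rewrite mulNmx !mulmxN opprK mulmxA.
set Z := w *m gi *m w *m gi.
have hgi : h *m gi = - (q / `|pf2 w w|) *: Z - 1%:M.
  by rewrite /h GE mulmxBl -scalemxAl mulmxV.
rewrite contract_formE hT giT -(mulmxA _ h) hgi.
have := YM_lagrangianE skw P0; rewrite -/Z; move: (YM_lagrangian g w) => y yE.
set c := - (q / _).
rewrite mulmxBl mulmxBr mul1mx mulmx1 -scalemxAl -scalemxAr scalerA.
rewrite metric_square // -/Z scalerBr scalerA scale_scalar_mx.
rewrite !(mxtraceD, mxtraceN, mxtraceZ) !mxtrace_scalar -qq.
rewrite yE /c -[pf2 w w ^+ 2]real_normK ?num_real //.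
move: P0; rewrite -normr_eq0 => P0.
by field; rewrite P0 gt_eqF.
Qed.

(** * Self-dual ([s] = 1) and anti-self-dual ([s] = -1) backgrounds *)

Section SelfDual.
Variables (wb : 'M[R]_4) (s : R) (n : nat) (N : 'M[R]_(4, n)).
Hypothesis skwb : wb^T = - wb.
Hypothesis s_sign : s = 1 \/ s = -1.
Hypothesis wb_selfdual : hodge g wb = s *: wb.
Hypothesis pfwb : pf2 wb wb != 0.
(** This factorization is the form in which positivity of the metric enters. *)
Hypothesis giN : gi = N *m N^T.

Let ss : s * s = 1. Proof. by case: s_sign => ->; rewrite ?mulrNN mulr1. Qed.

Lemma selfdualE : g *m dual wb *m g = (s * q) *: wb.
Proof.
have := wb_selfdual; rewrite hodge_dual // => /(congr1 (fun A => q *: A)).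
by rewrite !scalerA divff ?scale1r 1?mulrC // gt_eqF.
Qed.

(** Replacing [wb] by [s] times its Hodge star cancels both inverse metrics and leaves the trace of
    [F] times [dual wb], a polarized Pfaffian. *)
Lemma mxtrace_selfdual F : F^T = - F ->
  \tr (F *m gi *m wb *m gi) = - (4 * s / q) * pf2 F wb.
Proof.
move=> skF.
have wbE : wb = (s / q) *: (g *m dual wb *m g).
  by rewrite selfdualE scalerA mulrACA ss mul1r mulVf ?scale1r // gt_eqF.
rewrite [in LHS]wbE -!scalemxAr -scalemxAl !mulmxA mulmxKV // mulmxK // linearZ /=.
by rewrite mxtrace_mul_dual //; ring.
Qed.

(** Up to the positive factor q / 4 this number is the squared norm of [wb], which [giN] turns into
    the sum of squares of the entries of [B]. *)
Lemma selfdual_gt0 : 0 < s * pf2 wb wb.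
Proof.
rewrite lt_def mulf_neq0 //=; last first.
  by case: s_sign => ->; rewrite ?oppr_eq0 oner_eq0.
have : \tr (wb *m gi *m wb *m gi) <= 0.
  pose B := N^T *m wb *m N.
  have -> : \tr (wb *m gi *m wb *m gi) = - \tr (B^T *m B).
    rewrite /B !trmx_mul trmxK skwb !mulNmx mulmxN mulNmx linearN opprK giN.
    by rewrite /= !mulmxA [LHS]mxtrace_mulC !mulmxA.
  rewrite oppr_le0 -mxtrace_tr_mul.
  by apply: sumr_ge0 => i _; apply: sumr_ge0 => j _; rewrite -expr2 sqr_ge0.
rewrite mxtrace_selfdual // !mulNr oppr_le0 => H.
have -> : s * pf2 wb wb = q / 4 * (4 * s / q * pf2 wb wb).
  by field; rewrite gt_eqF.
by rewrite mulr_ge0 // divr_ge0 // ltW.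
Qed.

Lemma exp_background_sigma :
  expR (background_sigma g wb) = q / (s * pf2 wb wb).
Proof.
have E : invmx wb *m g *m invmx wb *m g = - (q / (s * pf2 wb wb)) *: 1%:M.
  rewrite invmx_skew // -!scalemxAl -!scalemxAr -!scalemxAl scalerA mulrNN.
  rewrite -!mulmxA (mulmxA g) selfdualE -scalemxAr dual_mulmx //.
  rewrite scalerA !scale_scalar_mx mulr1; congr _%:M.
  have sV : s^-1 = s by case: s_sign => ->; rewrite ?invrN invr1.
  by rewrite (invfM s) sV; field.
(* Positivity makes the logarithm a true witness, so that [xget] does not return its default
   value. *)
have q0 : 0 < q / (s * pf2 wb wb) by rewrite divr_gt0 // selfdual_gt0.
set S := [set t | invmx wb *m g *m invmx wb *m g = - expR t *: 1%:M].
have : S (background_sigma g wb).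
  by apply: xgetPex; exists (ln (q / (s * pf2 wb wb))); rewrite /S /= lnK ?posrE.
rewrite /S /= E => /matrixP/(_ ord0 ord0); rewrite !mxE eqxx /= !mulr1.
by move/oppr_inj.
Qed.

Lemma Pfaff_invmx : Pfaff (invmx wb) = (pf2 wb wb)^-1.
Proof.
have skV : (invmx wb)^T = - invmx wb.
  by rewrite invmx_skew // linearZ /= dualT scalerN.
rewrite Pfaff_skew // invmx_skew //.
rewrite pf2Z pf2_dual //; by field.
Qed.

(** Expand the square: the star is an isometry, which doubles the norm of [F], and the inner product
    of [F] with its star is 4 Pf F / q. *)
Lemma contract_hodge_sub F : F^T = - F ->
  let Fs := F - s *: hodge g F in
  contract_form g Fs Fs =
  2 * contract_form g F F - 8 * (s / q) * pf2 F F.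
Proof.
move=> skF Fs.
have skFs : Fs^T = - Fs.
  rewrite /Fs hodge_dual // linearB !linearZ /= !trmx_mul dualT gT skF.
  by rewrite !(mulNmx, mulmxN) mulmxA !scalerN opprD.
rewrite !contract_skew //.
have Fsgi : Fs *m gi = F *m gi - (s / q) *: (g *m dual F).
  by rewrite /Fs hodge_dual // mulmxBl -!scalemxAl mulmxK // scalerA.
rewrite -mulmxA Fsgi mulmxBl !mulmxBr -!scalemxAl -!scalemxAr scalerA !mulmxA.
rewrite !(mxtraceD, mxtraceN, mxtraceZ).
rewrite mxtrace_dual_metric // mulmxKV // mxtrace_mul_dual //.
have -> : \tr (g *m dual F *m F *m gi) = \tr (F *m dual F).
  by rewrite mxtrace_mulC !mulmxA mulVmx // mul1mx mxtrace_mulC.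
rewrite mxtrace_mul_dual // -qq.
have -> : s / q * (s / q) = (q ^+ 2)^-1 by rewrite mulrACA ss mul1r expr2 invfM.
by field; rewrite gt_eqF.
Qed.

(** By [contract_hodge_sub], for skew [F] this is s q / 8 times the squared norm of F - s star F. *)
Definition YM_quad F := s * q / 4 * contract_form g F F - pf2 F F.

(** The sign condition resolves the absolute value in [YM_lagrangianE] as |P| = s P. By
    [mxtrace_selfdual] the numerator then agrees with s P up to first order in [F]. *)
Lemma YM_expansion F : F^T = - F ->
  let P := pf2 wb wb + 2 * pf2 F wb + pf2 F F in
  0 < s * P -> YM_lagrangian g (wb + F) = 1 + YM_quad F / P.
Proof.
move=> skF P sP.
have PE : pf2 (wb + F) (wb + F) = P by exact: pf2_sum.
have P0 : P != 0 by apply: contraTneq sP => ->; rewrite mulr0 ltxx.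
have sk : (wb + F)^T = - (wb + F) by rewrite linearD /= skwb skF opprD.
have nP : `|P| = s * P.
  rewrite -(gtr0_norm sP) normrM.
  by case: s_sign => ->; rewrite ?normrN normr1 mul1r.
rewrite YM_lagrangianE ?PE // nP.
have -> : (wb + F) *m gi *m (wb + F) *m gi =
    wb *m gi *m wb *m gi + F *m gi *m wb *m gi + wb *m gi *m F *m gi
    + F *m gi *m F *m gi.
  by rewrite !(mulmxDl, mulmxDr) !addrA.
rewrite !mxtraceD.
have -> : \tr (wb *m gi *m F *m gi) = \tr (F *m gi *m wb *m gi).
  by rewrite -(mulmxA _ F) mxtrace_mulC !mulmxA.
rewrite !mxtrace_selfdual // /YM_quad contract_skew //.
have q0 : q != 0 by rewrite gt_eqF.
by have [->|->] := s_sign; rewrite /P; field; rewrite q0 -/P P0.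
Qed.
End SelfDual.
End Metric.

(** * Power series indexed by words *)

Section Words.
Variables (R : realType) (T : finType).
Implicit Types (c : seq T -> R) (x : T -> R) (l : T -> R) (m : T -> T -> R).

(** This is [homogeneous_part] over an arbitrary alphabet. Words are ordered, so a monomial may
    occur several times; in exchange, multiplication by a form acts on the first letters only. *)
Definition word_part c x n : R :=
  \sum_(w : n.-tuple T) c w * \prod_(a <- w) x a.

Definition lin_form l x : R := \sum_a l a * x a.

Definition quad_form m x : R := \sum_a lin_form (m a) x * x a.

(* lin_mul l c and quad_mul m c are the coefficients of the series with
   coefficients c times the form lin_form l, resp. quad_form m, put in front. *)
Definition lin_mul l c w : R := if w is a :: w' then l a * c w' else 0.

Definition quad_mul m c w : R := if w is a :: w' then lin_mul (m a) c w' else 0.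

Definition abs_coef c w : R := `|c w|.

Lemma sum_tuple_cons n (f : seq T -> R) :
  \sum_(w : n.+1.-tuple T) f w = \sum_a \sum_(w : n.-tuple T) f (a :: w).
Proof.
rewrite pair_bigA /= (reindex (fun p : T * n.-tuple T => [tuple of p.1 :: p.2])).
  by apply: eq_bigr => p _.
exists (fun w : n.+1.-tuple T => (thead w, [tuple of behead w])) => [[a w] _|w _].
  by congr pair; apply: val_inj.
by case/tupleP: w => a w; apply: val_inj.
Qed.

Lemma word_part0 c x : word_part c x 0 = c [::].
Proof.
rewrite /word_part (bigD1 [tuple]) //= big_nil mulr1 big1 ?addr0 // => w.
by case/eqP; exact: tuple0.
Qed.

Lemma word_partS c x n :
  word_part c x n.+1 = \sum_a x a * word_part (fun w => c (a :: w)) x n.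
Proof.
rewrite /word_part (sum_tuple_cons n (fun w => c w * \prod_(a <- w) x a)).
apply: eq_bigr => a _; rewrite mulr_sumr; apply: eq_bigr => w _.
by rewrite big_cons mulrCA.
Qed.

Lemma word_part_lincomb (a b : R) c d x n :
  word_part (fun w => a * c w + b * d w) x n =
  a * word_part c x n + b * word_part d x n.
Proof.
rewrite /word_part !mulr_sumr -big_split; apply: eq_bigr => w _ /=; ring.
Qed.

Lemma word_partZ (a : R) c x n :
  word_part (fun w => a * c w) x n = a * word_part c x n.
Proof. by rewrite /word_part mulr_sumr; apply: eq_bigr => w _; rewrite mulrA. Qed.

Lemma word_part_lin_mul l c x n :
  word_part (lin_mul l c) x n = if n is k.+1 then lin_form l x * word_part c x k else 0.
Proof.
case: n => [|n]; first by rewrite word_part0.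
rewrite word_partS /lin_form mulr_suml; apply: eq_bigr => a _.
by rewrite word_partZ mulrCA mulrA.
Qed.

Lemma word_part_quad_mul m c x n :
  word_part (quad_mul m c) x n =
  if n is k.+2 then quad_form m x * word_part c x k else 0.
Proof.
case: n => [|n]; first by rewrite word_part0.
rewrite word_partS /=; under eq_bigr do rewrite word_part_lin_mul.
case: n => [|n]; first by rewrite big1 // => a _; rewrite mulr0.
by rewrite /quad_form mulr_suml; apply: eq_bigr => a _; rewrite mulrCA mulrA.
Qed.

(** Multiplication by a linear form raises the degree by one. At [n] = 0 the truncated predecessor
    is harmless, since both partial sums are empty. *)
Lemma series_lin_mul l c x n :
  series (word_part (lin_mul l c) x) n =
  lin_form l x * series (word_part c x) n.-1.
Proof.
case: n => [|n]; first by rewrite /series /= !big_geq // mulr0.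
rewrite /series /= big_nat_recl // word_part_lin_mul add0r mulr_sumr.
by apply: eq_bigr => i _; rewrite word_part_lin_mul.
Qed.

Lemma series_quad_mul m c x n :
  series (word_part (quad_mul m c) x) n =
  quad_form m x * series (word_part c x) n.-2.
Proof.
case: n => [|[|n]]; first by rewrite /series /= !big_geq // mulr0.
  by rewrite /series /= big_nat1 big_geq // word_part_quad_mul mulr0.
rewrite /series /= !big_nat_recl // !word_part_quad_mul !add0r mulr_sumr.
by apply: eq_bigr => i _; rewrite word_part_quad_mul.
Qed.

Lemma series_lincomb (a b : R) c d x n :
  series (word_part (fun w => a * c w + b * d w) x) n =
  a * series (word_part c x) n + b * series (word_part d x) n.
Proof.
rewrite /series /= !mulr_sumr -big_split; apply: eq_bigr => i _.
exact: word_part_lincomb.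
Qed.

Lemma abs_lin_mul l c :
  abs_coef (lin_mul l c) = lin_mul (fun a => `|l a|) (abs_coef c).
Proof. by apply/funext => -[|a w] /=; rewrite /abs_coef ?normr0 // normrM. Qed.

Lemma abs_quad_mul m c :
  abs_coef (quad_mul m c) = quad_mul (fun a b => `|m a b|) (abs_coef c).
Proof.
apply/funext => -[|a w] /=; first by rewrite /abs_coef normr0.
by rewrite -[LHS]/(abs_coef (lin_mul (m a) c) w) abs_lin_mul.
Qed.

Lemma le_word_part c d x y n : (forall w, `|c w| <= d w) ->
  (forall a, `|x a| <= y a) -> `|word_part c x n| <= word_part d y n.
Proof.
move=> cd xy; rewrite /word_part (le_trans (ler_norm_sum _ _ _)) //.
apply: ler_sum => w _; rewrite normrM normr_prod ler_pM ?prodr_ge0 //.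
by apply: ler_prod => a _; rewrite normr_ge0 xy.
Qed.

Lemma word_part_ge0 c x n : (forall w, 0 <= c w) -> (forall a, 0 <= x a) ->
  0 <= word_part c x n.
Proof.
move=> c0 x0; apply: sumr_ge0 => w _; rewrite mulr_ge0 //.
exact: prodr_ge0.
Qed.

Lemma word_part_cst c (t : R) n :
  word_part c (fun=> t) n = (\sum_(w : n.-tuple T) c w) * t ^+ n.
Proof.
rewrite /word_part mulr_suml; apply: eq_bigr => w _.
by rewrite big_const_seq count_predT size_tuple iter_mulr mulr1.
Qed.

(** * Calculus of expansions with explicit order and bound *)

Section Expands.
Variables (t : R) (X : set (T -> R)).
Hypothesis t_ge0 : 0 <= t.
Hypothesis Xt : forall x, X x -> forall a, `|x a| <= t.

(* For t >= 0 this is the partial sum of the l1 norm of c with weights t^(size w). *)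
Let mass c n := series (word_part (abs_coef c) (fun=> t)) n.

(** The bound [C] is a parameter rather than existentially quantified, so that one value can serve a
    whole neighbourhood of points. For the same reason the rules below take upper bounds [K] of the
    coefficients. *)
Definition expands (k : nat) (C : R) (f : (T -> R) -> R) : Prop :=
  exists c, [/\ forall w, (size w < k)%N -> c w = 0,
    forall n, mass c n <= C &
    forall x, X x -> series (word_part c x) @ \oo --> f x].

Lemma word_part_abs_ge0 c n : 0 <= word_part (abs_coef c) (fun=> t) n.
Proof. by apply: word_part_ge0 => // w; exact: normr_ge0. Qed.

Lemma mass_nondecreasing c : {homo mass c : n p / (n <= p)%N >-> n <= p}.
Proof.
move=> n p np; rewrite /mass /series /= (big_cat_nat (leq0n n) np) /= lerDl.
by apply: sumr_ge0 => i _; exact: word_part_abs_ge0.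
Qed.

Lemma mass_ge0 c n : 0 <= mass c n.
Proof. by apply: sumr_ge0 => i _; exact: word_part_abs_ge0. Qed.

Lemma is_cvg_word_series c C x : (forall n, mass c n <= C) -> X x ->
  cvgn (series (word_part c x)).
Proof.
move=> cC Xx; apply: normed_cvg.
apply: nondecreasing_is_cvgn.
  move=> n p np; rewrite /= /series /= (big_cat_nat (leq0n n) np) /= lerDl.
  by apply: sumr_ge0 => i _ /=.
exists C => _ [n _ <-]; apply: le_trans (cC n).
apply: ler_sum => i _; apply: le_word_part => // a; exact: Xt.
Qed.

Lemma expands_eq k C f h : (forall x, X x -> f x = h x) ->
  expands k C f -> expands k C h.
Proof.
move=> fh [c [c0 cC cf]]; exists c; split=> // x Xx.
by rewrite -fh //; exact: cf.
Qed.

Lemma expands_le k k' C f : (k' <= k)%N -> expands k C f -> expands k' C f.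
Proof.
move=> kk' [c [c0 cC cf]]; exists c; split=> // w wk.
by apply: c0; apply: leq_trans kk'.
Qed.

Lemma expands_bound k C C' f : C <= C' -> expands k C f -> expands k C' f.
Proof.
move=> CC' [c [c0 cC cf]]; exists c; split=> // n.
exact: le_trans (cC n) CC'.
Qed.

Lemma expands_bound_ge0 k C f : expands k C f -> 0 <= C.
Proof. by move=> [c [_ /(_ 0%N)/(le_trans (mass_ge0 c 0)) + _]]. Qed.

Lemma expands1 : expands 0 1 (fun=> 1).
Proof.
exists (fun w => (w == [::])%:R).
have E x n : series (word_part (fun w => (w == [::])%:R) x) n.+1 = 1.
  rewrite /series /= big_nat_recl // word_part0 eqxx big1_seq ?addr0 // => i _.
  by rewrite word_partS big1 // => a _; rewrite /word_part big1 ?mulr0 // => w _; rewrite mul0r.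
split=> // [[|n]|x _].
- by rewrite /mass /series /= big_geq.
- rewrite /mass; have -> : abs_coef (fun w => (w == [::])%:R) = (fun w => (w == [::])%:R).
    by apply/funext => w; rewrite /abs_coef normr_nat.
  by rewrite E.
- by rewrite -cvg_shiftS (funext (E x)); exact: cvg_cst.
Qed.

Lemma expandsZ (a : R) K k C f : `|a| <= K -> expands k C f ->
  expands k (K * C) (fun x => a * f x).
Proof.
move=> aK ef; apply: (@expands_bound _ (`|a| * C)).
  by rewrite ler_wpM2r // (expands_bound_ge0 ef).
(* The null second term makes this an instance of [series_lincomb]. *)
move: ef => [c [c0 cC cf]]; exists (fun w => a * c w + 0 * c w); split=> [w wk|n|x Xx].
- by rewrite c0 // !mulr0 addr0.
- rewrite /mass; have -> : abs_coef (fun w => a * c w + 0 * c w) =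
     (fun w => `|a| * abs_coef c w + 0 * abs_coef c w).
    by apply/funext => w; rewrite /abs_coef !mul0r !addr0 normrM.
  by rewrite series_lincomb mul0r addr0 ler_wpM2l // cC.
- rewrite (funext (series_lincomb a 0 c c x)).
  under eq_fun do rewrite mul0r addr0.
  by apply: cvgM; [exact: cvg_cst | exact: cf].
Qed.

Lemma expandsD k C C' f h : expands k C f -> expands k C' h ->
  expands k (C + C') (fun x => f x + h x).
Proof.
move=> [c [c0 cC cf]] [d [d0 dC dh]].
exists (fun w => 1 * c w + 1 * d w); split=> [w wk|n|x Xx].
- by rewrite c0 // d0 // !mulr0 addr0.
- apply: (@le_trans _ _ (mass c n + mass d n)); last by rewrite lerD.
  have -> : mass c n + mass d n = series (word_part
      (fun w => 1 * abs_coef c w + 1 * abs_coef d w) (fun=> t)) n.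
    by rewrite series_lincomb !mul1r.
  apply: ler_sum => i _; rewrite (le_trans (ler_norm _)) // le_word_part //.
    by move=> w; rewrite /abs_coef !mul1r normr_id ler_normD.
  by move=> a; rewrite ger0_norm.
- rewrite (funext (series_lincomb 1 1 c d x)).
  under eq_fun do rewrite !mul1r.
  by apply: cvgD; [exact: cf | exact: dh].
Qed.

Lemma lin_form_cst l : lin_form l (fun=> t) = (\sum_a l a) * t.
Proof. by rewrite /lin_form mulr_suml. Qed.

Lemma quad_form_cst m : quad_form m (fun=> t) = (\sum_a \sum_b m a b) * t ^+ 2.
Proof.
rewrite /quad_form mulr_suml; apply: eq_bigr => a _.
by rewrite lin_form_cst -mulrA.
Qed.

Lemma expands_lin_form l K k C f : \sum_a `|l a| <= K -> expands k C f ->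
  expands k.+1 (K * t * C) (fun x => lin_form l x * f x).
Proof.
move=> lK ef; apply: (@expands_bound _ ((\sum_a `|l a|) * t * C)).
  by rewrite -!mulrA ler_wpM2r // mulr_ge0 // (expands_bound_ge0 ef).
move: ef => [c [c0 cC cf]]; exists (lin_mul l c); split=> [[|a w] wk|n|x Xx] //=.
- by rewrite c0 ?mulr0.
- rewrite /mass abs_lin_mul series_lin_mul lin_form_cst.
  by rewrite ler_wpM2l ?cC // mulr_ge0 // sumr_ge0.
- rewrite (funext (series_lin_mul l c x)).
  apply: cvgM; first exact: cvg_cst.
  by rewrite -cvg_shiftS; exact: cf.
Qed.

Lemma expands_quad_form m K k C f : \sum_a \sum_b `|m a b| <= K ->
  expands k C f ->
  expands k.+2 (K * t ^+ 2 * C) (fun x => quad_form m x * f x).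
Proof.
move=> mK ef.
apply: (@expands_bound _ ((\sum_a \sum_b `|m a b|) * t ^+ 2 * C)).
  have C0 := expands_bound_ge0 ef.
  by rewrite ler_wpM2r // ler_wpM2r // exprn_ge0.
move: ef => [c [c0 cC cf]]; exists (quad_mul m c); split=> [[|a [|b w]] wk|n|x Xx] //=.
- by rewrite c0 ?mulr0.
- rewrite /mass abs_quad_mul series_quad_mul quad_form_cst.
  rewrite ler_wpM2l ?cC // mulr_ge0 ?exprn_ge0 // sumr_ge0 // => a _.
  exact: sumr_ge0.
- rewrite (funext (series_quad_mul m c x)).
  apply: cvgM; first exact: cvg_cst.
  by rewrite -2!cvg_shiftS; exact: cf.
Qed.

(** * Division by a polynomial of degree two *)

Section Quotient.
Variables (p0 K : R) (l : T -> R) (m : T -> T -> R).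
Hypothesis p0_neq0 : p0 != 0.
Hypothesis p0K : `|p0^-1| <= K.
Hypothesis small :
  (\sum_a `|l a|) * t + (\sum_a \sum_b `|m a b|) * t ^+ 2 <= `|p0| / 2.

Lemma quotient_small x : X x -> `|lin_form l x + quad_form m x| <= `|p0| / 2.
Proof.
move=> Xx; apply: le_trans small; rewrite (le_trans (ler_normD _ _)) // lerD //.
  rewrite /lin_form mulr_suml (le_trans (ler_norm_sum _ _ _)) // ler_sum // => a _.
  by rewrite normrM ler_wpM2l // Xt.
rewrite /quad_form mulr_suml (le_trans (ler_norm_sum _ _ _)) // ler_sum // => a _.
rewrite normrM expr2 mulrA ler_pM // ?Xt // mulr_suml.
rewrite (le_trans (ler_norm_sum _ _ _)) // ler_sum // => b _.
by rewrite normrM ler_wpM2l // Xt.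
Qed.

(* Coefficients of the solution y of (p0 + lin_form l + quad_form m) y = c. *)
Fixpoint quotient_coef c w : R :=
  p0^-1 * (c w - (if w is a :: w' then
    l a * quotient_coef c w' +
    (if w' is b :: w'' then m a b * quotient_coef c w'' else 0) else 0)).

Lemma quotient_coefE c w :
  p0 * quotient_coef c w =
  c w - (lin_mul l (quotient_coef c) w + quad_mul m (quotient_coef c) w).
Proof.
by case: w => [|a [|b w]] /=; rewrite mulrA divff // mul1r ?addr0.
Qed.

(** The quotient is the solution of a linear equation: its coefficients obey a recursion, [small]
    bounds their l1 norm, and the sum of the series solves the equation in the limit. *)
Lemma expands_quotient k C f : expands k C f ->
  expands k (2 * C * K) (fun x => f x / (p0 + lin_form l x + quad_form m x)).
Proof.
move=> ef; apply: (@expands_bound _ (2 * C / `|p0|)).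
  by rewrite -normfV ler_wpM2l // mulr_ge0 // (expands_bound_ge0 ef).
move: ef => [c [c0 cC cf]]; set y := quotient_coef c; exists y.
have p0_gt0 : 0 < `|p0| by rewrite normr_gt0.
have yC n : mass y n <= 2 * C / `|p0|.
  (* The triangle inequality in the recursion, summed over words; [small] lets half of the left side
     absorb the terms in [y]. *)
  have H : `|p0| * mass y n <= C + `|p0| / 2 * mass y n.
    apply: (@le_trans _ _ (mass c n + (mass (lin_mul l y) n + mass (quad_mul m y) n))).
      rewrite mulr_sumr -!big_split; apply: ler_sum => i _ /=.
      rewrite /word_part mulr_sumr -!big_split; apply: ler_sum => w _ /=.
      rewrite mulrA -!mulrDl ler_wpM2r ?prodr_ge0 // /abs_coef -normrM.
      by rewrite quotient_coefE (le_trans (ler_normB _ _)) // lerD2l ler_normD.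
    rewrite lerD //; apply: (@le_trans _ _ (((\sum_a `|l a|) * t +
       (\sum_a \sum_b `|m a b|) * t ^+ 2) * mass y n)).
      rewrite /mass abs_lin_mul abs_quad_mul series_lin_mul series_quad_mul.
      rewrite lin_form_cst quad_form_cst mulrDl lerD // ler_wpM2l //.
      - by rewrite mulr_ge0 // sumr_ge0.
      - exact/mass_nondecreasing/leq_pred.
      - by rewrite mulr_ge0 ?exprn_ge0 // sumr_ge0 // => a _; rewrite sumr_ge0.
      - by apply/mass_nondecreasing/(leq_trans (leq_pred _))/leq_pred.
    by rewrite ler_wpM2r // mass_ge0.
  rewrite ler_pdivlMr //; lra.
split=> // [w|x Xx].
  (* Strong induction on the length, because the recursion drops one or two letters. *)
  have [n] := ubnP (size w); elim: n w => // n IHn w wn wk.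
  apply: (mulfI p0_neq0); rewrite quotient_coefE c0 // mulr0 sub0r -/y.
  case: w wn wk => [|a w] /= wn wk; first by rewrite addr0 oppr0.
  have yw : y w = 0 by apply: IHn => //; exact: ltnW.
  rewrite yw mulr0 add0r.
  case: w wn wk {yw} => [|b w] /= wn wk; first by rewrite oppr0.
  have -> : y w = 0 by apply: IHn; [exact: ltnW | exact/ltnW/ltnW].
  by rewrite mulr0 oppr0.
have cy := is_cvg_word_series yC Xx; rewrite cvg_ex in cy; case: cy => z cz.
suff <- : z = f x / (p0 + lin_form l x + quad_form m x) by [].
(* A zero would make the perturbation equal to - p0, whose modulus exceeds half of |p0|. *)
have P0 : p0 + lin_form l x + quad_form m x != 0.
  have := quotient_small Xx; apply: contraTneq => E.
  have -> : lin_form l x + quad_form m x = - p0.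
    by apply/eqP; rewrite -subr_eq0 opprK addrC addrA E.
  by rewrite normrN -ltNge ltr_pdivrMr // ltr_pMr // ltr1n.
apply/eqP; rewrite -(inj_eq (mulIf P0)) divfK //; apply/eqP.
(* The recursion on partial sums. The shifted indices do not change the limit, so uniqueness of
   limits identifies [z]. *)
have E n : series (word_part c x) n = p0 * series (word_part y x) n
    + (lin_form l x * series (word_part y x) n.-1
       + quad_form m x * series (word_part y x) n.-2).
  rewrite -series_lin_mul -series_quad_mul /series /= mulr_sumr -!big_split.
  apply: eq_bigr => i _; rewrite /= /word_part mulr_sumr -!big_split.
  apply: eq_bigr => w _ /=; rewrite mulrA -!mulrDl quotient_coefE -/y.
  by rewrite subrK.
have := cf x Xx; rewrite (funext E).
move=> H; apply: (cvg_unique (@norm_hausdorff _ _) _ H).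
have -> : z * (p0 + lin_form l x + quad_form m x) =
   p0 * z + (lin_form l x * z + quad_form m x * z) by ring.
apply: cvgD; first by apply: cvgM => //; exact: cvg_cst.
apply: cvgD; apply: cvgM; [exact: cvg_cst| |exact: cvg_cst|].
  by rewrite -cvg_shiftS.
by rewrite -2!cvg_shiftS.
Qed.
End Quotient.
End Expands.
End Words.

(** * Gram determinants and limits of matrices *)

Section Gram.
Variable R : realType.

Lemma row_dot_ge0 n (v : 'rV[R]_n) : 0 <= (v *m v^T) 0 0.
Proof. by rewrite mxE sumr_ge0 // => i _; rewrite mxE -expr2 sqr_ge0. Qed.

Lemma row_dot_eq0 n (v : 'rV[R]_n) : (v *m v^T) 0 0 = 0 -> v = 0.
Proof.
move=> /eqP; rewrite mxE psumr_eq0; last by move=> i _; rewrite mxE -expr2 sqr_ge0.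
move=> /allP v0; apply/rowP => i; have := v0 i; rewrite mem_index_enum.
by move=> /(_ isT)/eqP; rewrite !mxE => /eqP; rewrite mulf_eq0 orbb => /eqP.
Qed.

(* det (t + (1 - t) T T^T) has no zero for t in [0, 1], and equals 1 at t = 1. *)
Lemma det_gram_gt0 n D (T : 'M[R]_(n, D)) : row_free T -> 0 < \det (T *m T^T).
Proof.
move=> Tfree; rewrite ltNge; apply/negP => g_le0.
pose p : {poly R} :=
  \det ((1 - 'X) *: map_mx polyC (T *m T^T) + ('X)%:M).
have pE t : p.[t] = \det ((1 - t) *: (T *m T^T) + t%:M).
  rewrite -[p.[t]]/(horner_eval t p) -det_map_mx; congr (\det _).
  apply/matrixP => i j; rewrite !mxE /= /horner_eval hornerD hornerM hornerMn.
  by rewrite hornerD hornerN hornerX !hornerC.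
have [||t /andP[t0 t1] /rootP] := @poly_ivt _ p 0 1; first exact: ler01.
  by rewrite !pE !subr0 subrr scale1r scale0r add0r raddf0 addr0 det1 g_le0 ler01.
rewrite pE => /eqP/det0P[v v0 /(congr1 (fun A => (A *m v^T) 0 0))].
rewrite mulmxDr -scalemxAr mul_mx_scalar mulmxDl -!scalemxAl mul0mx.
have -> : v *m (T *m T^T) *m v^T = (v *m T) *m (v *m T)^T.
  by rewrite trmx_mul !mulmxA.
rewrite mxE [X in X + _]mxE [X in _ + X]mxE [RHS]mxE.
move/eqP; rewrite paddr_eq0 ?mulr_ge0 ?row_dot_ge0 ?subr_ge0 // !mulf_eq0.
case/andP => /orP[|/eqP/row_dot_eq0 vT]; last first.
  by move: v0; rewrite -(inj_eq (row_free_inj Tfree)) vT mul0mx eqxx.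
rewrite subr_eq0 => /eqP <-; rewrite oner_eq0 /= => /eqP/row_dot_eq0.
by apply/eqP.
Qed.
End Gram.

Section Limits.
Variables (R : realType) (V : Type) (F : set_system V).
Hypothesis FF : Filter F.

Lemma cvg_sumr (I : Type) (r : seq I) (P : pred I) (f : I -> V -> R) (l : I -> R) :
  (forall i, P i -> f i v @[v --> F] --> l i) ->
  \sum_(i <- r | P i) f i v @[v --> F] --> \sum_(i <- r | P i) l i.
Proof. by move=> fl; apply: cvg_big => //; exact: add_continuous. Qed.

Lemma cvg_prodr (I : Type) (r : seq I) (P : pred I) (f : I -> V -> R) (l : I -> R) :
  (forall i, P i -> f i v @[v --> F] --> l i) ->
  \prod_(i <- r | P i) f i v @[v --> F] --> \prod_(i <- r | P i) l i.
Proof. by move=> fl; apply: cvg_big => //; exact: mul_continuous. Qed.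

Lemma cvg_det n (A : V -> 'M[R]_n) (B : 'M[R]_n) :
  (forall i j, A v i j @[v --> F] --> B i j) -> \det (A v) @[v --> F] --> \det B.
Proof.
move=> AB; apply: cvg_sumr => p _; apply: cvgM; first exact: cvg_cst.
exact: cvg_prodr.
Qed.

Lemma cvg_invmx n (A : V -> 'M[R]_n) (B : 'M[R]_n) :
  (forall i j, A v i j @[v --> F] --> B i j) -> B \in unitmx ->
  (\forall v \near F, A v \in unitmx) ->
  forall i j, invmx (A v) i j @[v --> F] --> invmx B i j.
Proof.
move=> AB Bu Au i j.
(* [invmx] returns a singular matrix unchanged, so the adjugate formula is available only where the
   matrices are invertible. *)
have E (C : 'M[R]_n) : C \in unitmx -> invmx C i j = (\det C)^-1 * \adj C i j.
  by move=> Cu; rewrite /invmx Cu mxE.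
rewrite E //.
apply: (@cvg_trans _ ((fun v => (\det (A v))^-1 * \adj (A v) i j) @ F)).
  by apply: near_eq_cvg; near=> v; rewrite -E //; near: v.
apply: cvgM.
  by apply: cvgV; [rewrite -unitfE -unitmxE | exact: cvg_det].
rewrite mxE (_ : (fun v => _) = (fun v => cofactor (A v) j i)); last first.
  by apply/funext => v; rewrite mxE.
apply: cvgM; first exact: cvg_cst.
apply: cvg_det => k l; rewrite !mxE.
rewrite (_ : (fun v => _) = (fun v => A v (lift j k) (lift i l))) //.
by apply/funext => v; rewrite !mxE.
Unshelve. all: by end_near. Qed.
End Limits.

(** * The remainders *)

Section Remainder.
Variable R : realType.
Implicit Types (g w F : 'M[R]_4).

Definition entries F (p : 'I_4 * 'I_4) : R := F p.1 p.2.

Definition small_entries (t : R) : set ('I_4 * 'I_4 -> R) :=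
  [set x | exists F : 'M[R]_4,
    [/\ F^T = - F, forall mu nu, `|F mu nu| <= t & x = entries F]].

(** Coefficients, over all sixteen entries of [F], of the part of Pf (w + F) linear in [F]. *)
Definition polar_coef w (p : 'I_4 * 'I_4) : R :=
  4^-1 * \sum_k \sum_l levi_civita R p.1 p.2 k l * w k l.

Definition pf_coef (p r : 'I_4 * 'I_4) : R :=
  8^-1 * levi_civita R p.1 p.2 r.1 r.2.

Definition YM_quad_coef g (s : R) (p r : 'I_4 * 'I_4) : R :=
  s * Num.sqrt (\det g) / 4 * (invmx g p.1 r.1 * invmx g p.2 r.2) - pf_coef p r.

Lemma sum_pair (f : 'I_4 -> 'I_4 -> R) :
  \sum_p f p.1 p.2 = \sum_i \sum_j f i j.
Proof. by rewrite pair_bigA. Qed.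

Lemma lin_form_polar F w : F^T = - F -> w^T = - w ->
  lin_form (polar_coef w) (entries F) = 2 * pf2 F w.
Proof.
move=> skF skw.
have -> : 2 * pf2 F w = 4^-1 * (8 * pf2 F w) by field.
rewrite -levi_civita_pf2 // /lin_form.
rewrite (sum_pair (fun i j => polar_coef w (i, j) * F i j)) mulr_sumr.
apply: eq_bigr => i _; rewrite mulr_sumr; apply: eq_bigr => j _.
rewrite /polar_coef /= -mulrA; congr (_ * _).
rewrite mulr_suml; apply: eq_bigr => k _; rewrite mulr_suml.
by apply: eq_bigr => l _; rewrite mulrAC.
Qed.

Lemma quad_form_pair (m : 'I_4 -> 'I_4 -> 'I_4 -> 'I_4 -> R) F :
  quad_form (fun p r => m p.1 p.2 r.1 r.2) (entries F) =
  \sum_i \sum_j \sum_k \sum_l m i j k l * F k l * F i j.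
Proof.
rewrite /quad_form (sum_pair (fun i j =>
  lin_form (fun r => m i j r.1 r.2) (entries F) * F i j)).
apply: eq_bigr => i _; apply: eq_bigr => j _.
rewrite /lin_form (sum_pair (fun k l => m i j k l * F k l)) mulr_suml.
by apply: eq_bigr => k _; rewrite mulr_suml.
Qed.

Lemma quad_form_pf F : F^T = - F -> quad_form pf_coef (entries F) = pf2 F F.
Proof.
move=> skF.
have -> : pf2 F F = 8^-1 * (8 * pf2 F F) by field.
rewrite -levi_civita_pf2 //.
rewrite (quad_form_pair (fun i j k l => 8^-1 * levi_civita R i j k l)).
do 4 (rewrite mulr_sumr; apply: eq_bigr => ? _).
ring.
Qed.

Lemma quad_form_YM g s F : F^T = - F ->
  quad_form (YM_quad_coef g s) (entries F) = YM_quad g s F.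
Proof.
move=> skF; rewrite /YM_quad -quad_form_pf //.
rewrite (quad_form_pair (fun i j k l => s * Num.sqrt (\det g) / 4 *
  (invmx g i k * invmx g j l) - pf_coef (i, j) (k, l))).
rewrite (quad_form_pair (fun i j k l => pf_coef (i, j) (k, l))).
rewrite /contract_form mulr_sumr -sumrB; apply: eq_bigr => i _.
rewrite mulr_sumr -sumrB; apply: eq_bigr => j _.
rewrite mulr_sumr -sumrB; apply: eq_bigr => k _.
rewrite mulr_sumr -sumrB; apply: eq_bigr => l _.
ring.
Qed.

(* The remainders are the exact differences, for all F; they are expanded only
   near F = 0. *)
Definition remainder1 g w F : R :=
  YM_lagrangian g (w + F) -
  (1 + 8^-1 * contract_form g (effective_metric g (w + F) - g)
                              (effective_metric g (w + F) - g)).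

Definition remainder2 g w F : R :=
  YM_lagrangian g (w + F) -
  (1 + 4^-1 * expR (background_sigma g w) * contract_form g F F
     - Pfaff F * Pfaff (invmx w)).

Definition remainder3 g w (s : R) F : R :=
  YM_lagrangian g (w + F) -
  (1 + 8^-1 * expR (background_sigma g w) *
       contract_form g (F - s *: hodge g F) (F - s *: hodge g F)).

Section Background.
Variables (g w : 'M[R]_4) (s : R) (n : nat) (N : 'M[R]_(4, n)).
Hypothesis gT : g^T = g.
Hypothesis g_gt0 : 0 < \det g.
Hypothesis skw : w^T = - w.
Hypothesis s_sign : s = 1 \/ s = -1.
Hypothesis w_selfdual : hodge g w = s *: w.
Hypothesis pfw : pf2 w w != 0.
Hypothesis giN : invmx g = N *m N^T.

Let p0 := pf2 w w.
Let P F := p0 + 2 * pf2 F w + pf2 F F.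
Let Q F := YM_quad g s F.

(** The perturbation can consume at most half of s p0, which is positive by [selfdual_gt0]. *)
Lemma pf_perturbation F : `|2 * pf2 F w + pf2 F F| <= `|p0| / 2 -> 0 < s * P F.
Proof.
have sp0 : 0 < s * p0 by apply: (selfdual_gt0 _ _ _ _ _ _ giN).
have n1 : `|s| = 1 by case: s_sign => ->; rewrite ?normrN normr1.
have -> : `|p0| = s * p0 by rewrite -(gtr0_norm sp0) (normrM s) n1 mul1r.
move=> small; have : `|s * (2 * pf2 F w + pf2 F F)| <= s * p0 / 2.
  by rewrite (normrM s) n1 mul1r.
have -> : s * P F = s * p0 + s * (2 * pf2 F w + pf2 F F) by rewrite /P; ring.
rewrite ler_norml => /andP[+ _].
move: (s * p0) (s * (2 * pf2 F w + pf2 F F)) sp0 => a b; lra.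
Qed.

Variable F : 'M[R]_4.
Hypothesis skF : F^T = - F.
Hypothesis small : `|2 * pf2 F w + pf2 F F| <= `|p0| / 2.

Let sP : 0 < s * P F. Proof. exact: pf_perturbation. Qed.

Let YM_E : YM_lagrangian g (w + F) = 1 + Q F / P F.
Proof. exact: YM_expansion. Qed.

Let P_neq0 : P F != 0.
Proof. by apply: contraTneq sP => ->; rewrite mulr0 ltxx. Qed.

(** This is - (Q / P)^2, nested so that each operation matches one rule for [expands]. *)
Lemma remainder1E : remainder1 g w F = - 1 * (Q F * (Q F * (1 / P F) / P F)).
Proof.
have sk : (w + F)^T = - (w + F) by rewrite linearD /= skw skF opprD.
rewrite /remainder1 contract_effective_sub //; last first.
  by rewrite pf2_sum.
by rewrite YM_E; move: (Q F) (P F) P_neq0 => a b b0; field.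
Qed.

Lemma remainder2E :
  remainder2 g w F = - p0^-1 * (Q F * (2 * pf2 F w * (1 / P F) + pf2 F F * (1 / P F))).
Proof.
rewrite /remainder2 YM_E (exp_background_sigma gT g_gt0 skw s_sign w_selfdual pfw giN).
rewrite Pfaff_skew // Pfaff_invmx //.
have PE : P F = p0 + 2 * pf2 F w + pf2 F F by [].
rewrite -/p0 /Q /YM_quad; move: P_neq0; rewrite PE => P0.
by case: s_sign => ->; field; rewrite P0 pfw.
Qed.

(** The second and third forms have exactly the same leading terms, by [contract_hodge_sub] and the
    value q / (s p0) of the background exponential. *)
Lemma remainder3E : remainder3 g w s F = remainder2 g w F.
Proof.
rewrite /remainder3 /remainder2 contract_hodge_sub //.
rewrite (exp_background_sigma gT g_gt0 skw s_sign w_selfdual pfw giN) Pfaff_skew // Pfaff_invmx //.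
congr (_ - _); rewrite -addrA; congr (1 + _).
have q0 : Num.sqrt (\det g) != 0 by rewrite gt_eqF // sqrtr_gt0.
by case: s_sign => ->; field; rewrite pfw.
Qed.
End Background.
End Remainder.

(** * Uniform radius and bounds for the expansions *)

Section Uniform.
Variable R : realType.

Definition mx_of (x : 'I_4 * 'I_4 -> R) : 'M[R]_4 := \matrix_(i, j) x (i, j).

Lemma entriesK : cancel (@entries R) mx_of.
Proof. by move=> F; apply/matrixP => i j; rewrite mxE. Qed.

(** The radius is chosen so that K t + K t^2 <= 2 K t = 1 / (2 K) <= |p0| / 2, the smallness needed
    for division by the Pfaffian. [C1] and [C2] precede [g] and [w], so they depend on [K] and [s]
    at most. *)
Lemma remainder_expands (K s : R) : 1 <= K -> s = 1 \/ s = -1 ->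
  let t := (4 * K ^+ 2)^-1 in
  let X := small_entries t in
  exists C1 C2, forall (g w : 'M[R]_4) n (N : 'M[R]_(4, n)),
    g^T = g -> 0 < \det g -> w^T = - w -> hodge g w = s *: w ->
    pf2 w w != 0 -> invmx g = N *m N^T ->
    [/\ `|(pf2 w w)^-1| <= K, \sum_p `|polar_coef w p| <= K,
        \sum_p \sum_r `|pf_coef R p r| <= K &
        \sum_p \sum_r `|YM_quad_coef g s p r| <= K] ->
    [/\ expands t X 3 C1 (fun x => remainder1 g w (mx_of x)),
        expands t X 3 C2 (fun x => remainder2 g w (mx_of x)) &
        expands t X 3 C2 (fun x => remainder3 g w s (mx_of x))].
Proof.
(* The two bounds are left open and are read off from [E1] and [E2]. *)
move=> K1 s_sign t X; eexists; eexists => g w n N gT g_gt0 skw sd pfw giN.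
have K_gt0 : 0 < K by exact: lt_le_trans K1.
have t_gt0 : 0 < t by rewrite invr_gt0 mulr_gt0 // exprn_gt0.
have t_ge0 := ltW t_gt0.
have t_le1 : t <= 1.
  rewrite invf_le1 ?mulr_gt0 ?exprn_gt0 //.
  by have := exprn_ege1 2 K1; lra.
move=> [p0K lK mK qK]; set p0 := pf2 w w.
have Xt x : X x -> forall a, `|x a| <= t by move=> [F [_ Ft ->]] a; exact: Ft.
have small : (\sum_p `|polar_coef w p|) * t +
    (\sum_p \sum_r `|pf_coef R p r|) * t ^+ 2 <= `|p0| / 2.
  apply: (@le_trans _ _ (K * t + K * t)).
    rewrite lerD ?ler_wpM2r // ler_pM ?exprn_ge0 //.
      by rewrite sumr_ge0 // => p _; rewrite sumr_ge0.
    by rewrite expr2 ler_piMr.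
  have -> : K * t + K * t = K^-1 / 2 by rewrite /t; field; rewrite gt_eqF.
  rewrite ler_pM2r ?invr_gt0 // -[leRHS]invrK lef_pV2 ?posrE ?invr_gt0 ?normr_gt0 //.
  by rewrite -normfV.
have P1 := expands_quotient t_ge0 Xt pfw p0K small (expands1 t X).
have Q1 := expands_quad_form t_ge0 qK P1.
have Q2 := expands_quotient t_ge0 Xt pfw p0K small Q1.
have Q3 := expands_quad_form t_ge0 qK Q2.
have N1 : `|- 1 : R| <= 1 by rewrite normrN normr1.
have Np0 : `|- p0^-1| <= K by rewrite normrN.
(* Two factors Q give order four, which is weakened to three. *)
have E1 := expands_le (isT : (3 <= 4)%N) (expandsZ t_ge0 N1 Q3).
have L1 := expands_lin_form t_ge0 lK P1.
(* The order is lowered to match [L1], so that the two can be added. *)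
have M1 := expands_le (isT : (1 <= 2)%N) (expands_quad_form t_ge0 mK P1).
have E2 := expandsZ t_ge0 Np0 (expands_quad_form t_ge0 qK (expandsD t_ge0 L1 M1)).
have smallF F : F^T = - F -> (forall mu nu, `|F mu nu| <= t) ->
    `|2 * pf2 F w + pf2 F F| <= `|p0| / 2.
  move=> skF Ft; rewrite -lin_form_polar // -quad_form_pf //.
  by apply: (quotient_small Xt small); exists F.
split.
- apply: expands_eq E1 => x [F [skF Ft ->]]; rewrite entriesK.
  rewrite (remainder1E gT g_gt0 skw s_sign sd pfw giN skF (smallF F skF Ft)).
  by rewrite quad_form_YM // lin_form_polar // quad_form_pf.
- apply: expands_eq E2 => x [F [skF Ft ->]]; rewrite entriesK.
  rewrite (remainder2E gT g_gt0 skw s_sign sd pfw giN skF (smallF F skF Ft)).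
  by rewrite quad_form_YM // lin_form_polar // quad_form_pf.
- apply: expands_eq E2 => x [F [skF Ft ->]]; rewrite entriesK.
  rewrite (remainder3E gT g_gt0 skw s_sign sd pfw giN skF).
  rewrite (remainder2E gT g_gt0 skw s_sign sd pfw giN skF (smallF F skF Ft)).
  by rewrite quad_form_YM // lin_form_polar // quad_form_pf.
Qed.

Lemma O_F3I (D : nat) (M : manifold4 R D) (r : nat -> 'rV[R]_4 -> 'M[R]_4 -> R) :
  (forall i u, dom M i u -> exists t C, 0 < t /\
     \forall v \near u,
       expands t (small_entries t) 3 C (fun x => r i v (mx_of x))) ->
  O_F3 M r.
Proof.
move=> H i u /(H i u)[t [C [t_gt0 Hu]]].
(* [O_F3] asks for the coefficients as a function of the point, so a family is chosen at each [v],
   with value 0 where none exists. *)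
pose S v := [set c : seq ('I_4 * 'I_4) -> R |
  [/\ forall w, (size w < 3)%N -> c w = 0,
      forall n, series (word_part (abs_coef c) (fun=> t)) n <= C &
      forall x, small_entries t x ->
        series (word_part c x) @ \oo --> r i v (mx_of x)]].
exists (fun v => xget (fun=> 0) (S v)), t, C; split=> //.
near=> v; have [c0 cC cr] : S v (xget (fun=> 0) (S v)).
  by apply: xgetPex; near: v.
split=> // [n|F skF Ft].
  rewrite (le_trans _ (cC n)) // /series /= big_mkord.
  by apply: ler_sum => k _; rewrite word_part_cst.
have := cr (entries F); rewrite entriesK; apply.
by exists F.
Unshelve. all: by end_near. Qed.
End Uniform.

Section CoefMass.
Variables (R : realType) (s : R).

(* Dominates all the data that enter the radius of convergence and the bound in
   remainder_expands. *)
Definition coef_mass (g w : 'M[R]_4) : R :=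
  `|(pf2 w w)^-1| + \sum_p `|polar_coef w p| +
  \sum_p \sum_r `|pf_coef R p r| + \sum_p \sum_r `|YM_quad_coef g s p r|.

Lemma coef_mass_ge g w (K : R) : coef_mass g w <= K ->
  [/\ `|(pf2 w w)^-1| <= K, \sum_p `|polar_coef w p| <= K,
      \sum_p \sum_r `|pf_coef R p r| <= K &
      \sum_p \sum_r `|YM_quad_coef g s p r| <= K].
Proof.
rewrite /coef_mass.
have : 0 <= `|(pf2 w w)^-1| by [].
have : 0 <= \sum_p `|polar_coef w p| by exact: sumr_ge0.
have : 0 <= \sum_p \sum_r `|pf_coef R p r|.
  by apply: sumr_ge0 => p _; exact: sumr_ge0.
have : 0 <= \sum_p \sum_r `|YM_quad_coef g s p r|.
  by apply: sumr_ge0 => p _; exact: sumr_ge0.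
set a := \sum_p \sum_r _; set b := \sum_p \sum_r _; set c := \sum_p _.
by set d := `| _ |; move=> a0 b0 c0 d0 H; split; lra.
Qed.

Lemma coef_mass_ge0 g w : 0 <= coef_mass g w.
Proof.
by rewrite !addr_ge0 // ?sumr_ge0 // => p _; rewrite sumr_ge0.
Qed.

(** Continuity of the data makes them locally bounded, which gives a locally uniform radius and
    bound. *)
Lemma cvg_coef_mass (V : Type) (F : set_system V) (FF : Filter F)
    (g w : V -> 'M[R]_4) (g0 w0 : 'M[R]_4) :
  (forall i j, g v i j @[v --> F] --> g0 i j) ->
  (forall i j, w v i j @[v --> F] --> w0 i j) ->
  g0 \in unitmx -> (\forall v \near F, g v \in unitmx) ->
  0 < \det g0 -> pf2 w0 w0 != 0 ->
  coef_mass (g v) (w v) @[v --> F] --> coef_mass g0 w0.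
Proof.
move=> gF wF g0U gU g0_gt0 pf0.
have cstF (c : R) : c @[v --> F] --> c by exact: cvg_cst.
have pfF : pf2 (w v) (w v) @[v --> F] --> pf2 w0 w0.
  apply: cvgM; first exact: cstF.
  by apply: cvgD; [apply: cvgB; [apply: cvgD; [apply: cvgD; [apply: cvgB|]|]|]|];
    apply: cvgM; exact: wF.
have detF : Num.sqrt (\det (g v)) @[v --> F] --> Num.sqrt (\det g0).
  apply: cvg_comp (cvg_det _ gF) _; exact: sqrt_continuous.
have invF := cvg_invmx FF gF g0U gU.
apply: cvgD; [apply: cvgD; [apply: cvgD|]|].
- by apply: cvg_norm; apply: cvgV.
- apply: cvg_sumr => p _; apply: cvg_norm; apply: cvgM; first exact: cstF.
  apply: cvg_sumr => k _; apply: cvg_sumr => l _.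
  by apply: cvgM; [exact: cstF | exact: wF].
- exact: cstF.
- apply: cvg_sumr => p _; apply: cvg_sumr => r _; apply: cvg_norm.
  apply: cvgB; last exact: cstF.
  apply: cvgM; last by apply: cvgM; exact: invF.
  by apply: cvgM; [apply: cvgM => // | exact: cstF].
Qed.
End CoefMass.

(** * The induced metric and the background on the manifold *)

Section Geometry.
Variables (R : realType) (D : nat) (M : manifold4 R D).

Lemma induced_metricE i u :
  induced_metric M i u = tangent (chart M i) u *m (tangent (chart M i) u)^T.
Proof.
by apply/matrixP => mu nu; rewrite !mxE; apply: eq_bigr => a _; rewrite !mxE.
Qed.

Lemma induced_metric_sym i u : (induced_metric M i u)^T = induced_metric M i u.
Proof. by rewrite induced_metricE trmx_mul trmxK. Qed.

Lemma det_induced_metric_gt0 i u : dom M i u -> 0 < \det (induced_metric M i u).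
Proof. by move=> du; rewrite induced_metricE det_gram_gt0 // chart_immersion. Qed.

(** With g = T T^T for the tangent matrix T, the product g^{-1} T T^T g^{-1} collapses to g^{-1};
    this supplies the factorization [giN]. *)
Lemma invmx_induced_metric i u : dom M i u ->
  let N := invmx (induced_metric M i u) *m tangent (chart M i) u in
  invmx (induced_metric M i u) = N *m N^T.
Proof.
move=> du N; have gU : induced_metric M i u \in unitmx.
  by rewrite unitmxE unitfE gt_eqF // det_induced_metric_gt0.
rewrite /N trmx_mul trmx_inv induced_metric_sym mulmxA -(mulmxA _ _ (_^T)).
by rewrite -induced_metricE mulVmx // mul1mx.
Qed.

Lemma induced_metric_cvg i u mu nu : dom M i u ->
  induced_metric M i v mu nu @[v --> u] --> induced_metric M i u mu nu.
Proof.
move=> du.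
have tanE a rho v : tangent (chart M i) v rho a =
    partial rho (fun v => chart M i v 0 a) v by rewrite mxE.
have tan_cvg a rho :
    tangent (chart M i) v rho a @[v --> u] --> tangent (chart M i) u rho a.
  rewrite tanE (funext (tanE a rho)).
  (* Smoothness at order one contains the continuity of the first partial derivatives. *)
  by have [_ /(_ rho)[_ [/(_ u du)]]] := @chart_smooth _ _ M i a 1%N.
have gE v : induced_metric M i v mu nu = \sum_(a < D)
  tangent (chart M i) v mu a * tangent (chart M i) v nu a by rewrite mxE.
rewrite gE (funext gE).
by apply: (cvg_sumr (nbhs_filter u)) => a _; apply: cvgM; exact: tan_cvg.
Qed.

Section Background.
Variables (wb : nat -> 'rV[R]_4 -> 'M[R]_4) (s : R).
Hypothesis wb_form : two_form M wb.
Hypothesis wb_nondeg : nondegenerate_form M wb.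
Hypothesis s_sign : s = 1 \/ s = -1.
Hypothesis wb_selfdual : forall i u, dom M i u ->
  hodge (induced_metric M i u) (wb i u) = s *: wb i u.

Let skwb i u : dom M i u -> (wb i u)^T = - wb i u.
Proof. by case: wb_form => _ + _; apply. Qed.

Let pfwb i u : dom M i u -> pf2 (wb i u) (wb i u) != 0.
Proof. by move=> du; rewrite -skew_unit ?skwb ?wb_nondeg. Qed.

Lemma locally_bounded_coefs i u : dom M i u -> exists2 K : R, 1 <= K &
  \forall v \near u, dom M i v /\
    coef_mass s (induced_metric M i v) (wb i v) <= K.
Proof.
move=> du; pose h v := coef_mass s (induced_metric M i v) (wb i v).
have dom_near : \forall v \near u, dom M i v.
  by apply: open_nbhs_nbhs; split=> //; exact: dom_open.
have hu : h v @[v --> u] --> h u.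
  apply: (cvg_coef_mass (nbhs_filter u)).
  - by move=> mu nu; exact: induced_metric_cvg.
  - move=> mu nu; case: wb_form => /(_ i mu nu 0%N)[H _] _ _.
    exact: (H u du).
  - by rewrite unitmxE unitfE gt_eqF // det_induced_metric_gt0.
  - near=> v; rewrite unitmxE unitfE gt_eqF // det_induced_metric_gt0 //.
    by near: v.
  - exact: det_induced_metric_gt0.
  - exact: pfwb.
(* Adding 1 leaves room for continuity and also ensures 1 <= K. *)
exists (h u + 1); first by rewrite lerDr coef_mass_ge0.
near=> v; split; first by near: v.
apply: ltW; near: v; apply: (cvgr_lt _ hu); by rewrite ltrDl.
Unshelve. all: by end_near. Qed.

Lemma remainders_O_F3 :
  [/\ O_F3 M (fun i u => remainder1 (induced_metric M i u) (wb i u)),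
      O_F3 M (fun i u => remainder2 (induced_metric M i u) (wb i u)) &
      O_F3 M (fun i u => remainder3 (induced_metric M i u) (wb i u) s)].
Proof.
suff H i u : dom M i u -> exists t C1 C2, 0 < t /\ \forall v \near u,
    [/\ expands t (small_entries t) 3 C1 (fun x =>
          remainder1 (induced_metric M i v) (wb i v) (mx_of x)),
        expands t (small_entries t) 3 C2 (fun x =>
          remainder2 (induced_metric M i v) (wb i v) (mx_of x)) &
        expands t (small_entries t) 3 C2 (fun x =>
          remainder3 (induced_metric M i v) (wb i v) s (mx_of x))].
  split; apply: O_F3I => i u /H[t [C1 [C2 [t_gt0 near_u]]]].
  - by exists t, C1; split=> //; apply: filterS near_u => v [].
  - by exists t, C2; split=> //; apply: filterS near_u => v [].
  - by exists t, C2; split=> //; apply: filterS near_u => v [].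
move=> /locally_bounded_coefs[K K1 near_u].
have [C1 [C2 expand]] := remainder_expands K1 s_sign.
exists (4 * K ^+ 2)^-1, C1, C2; split.
  by rewrite invr_gt0 mulr_gt0 // exprn_gt0 // (lt_le_trans ltr01).
apply: filterS near_u => v [dv /coef_mass_ge bounds].
apply: expand bounds.
- exact: induced_metric_sym.
- exact: det_induced_metric_gt0.
- exact: skwb.
- exact: wb_selfdual.
- exact: pfwb.
- exact: invmx_induced_metric.
Qed.
End Background.
End Geometry.


Theorem mainTheorem2 (R : realType) (D : nat) (M : manifold4 R D)
    (wb : nat -> 'rV[R]_4 -> 'M[R]_4) (s : R)
    (wb_symplectic : symplectic M wb)
    (s_sign : s = 1 \/ s = -1)
    (wb_selfdual : forall i u, dom M i u ->
       hodge (induced_metric M i u) (wb i u) = s *: wb i u) :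
  exists r1 r2 r3 : nat -> 'rV[R]_4 -> 'M[R]_4 -> R,
    [/\ O_F3 M r1, O_F3 M r2, O_F3 M r3 &
      forall A : nat -> 'rV[R]_4 -> 'rV[R]_4,
        one_form M A ->
        nondegenerate_form M (fun i u => wb i u + field_strength A i u) ->
        let g := induced_metric M in
        let F := field_strength A in
        let tinv i u : 'M[R]_4 := wb i u + F i u in
        let h i u : 'M[R]_4 := effective_metric (g i u) (tinv i u) - g i u in
        let sigmab i u : R := background_sigma (g i u) (wb i u) in
        let Fs i u : 'M[R]_4 := F i u - s *: hodge (g i u) (F i u) in
        let L1 i u : R :=
          1 + 8^-1 * contract_form (g i u) (h i u) (h i u) + r1 i u (F i u) in
        let L2 i u : R :=
          1 + 4^-1 * expR (sigmab i u) * contract_form (g i u) (F i u) (F i u)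
            - Pfaff (F i u) * Pfaff (invmx (wb i u)) + r2 i u (F i u) in
        let L3 i u : R :=
          1 + 8^-1 * expR (sigmab i u) * contract_form (g i u) (Fs i u) (Fs i u)
            + r3 i u (F i u) in
        (forall i u, dom M i u ->
           [/\ YM_lagrangian (g i u) (tinv i u) = L1 i u,
               YM_lagrangian (g i u) (tinv i u) = L2 i u &
               YM_lagrangian (g i u) (tinv i u) = L3 i u]) /\
        [/\ S_YM M tinv = integral_M M L1,
            S_YM M tinv = integral_M M L2 &
            S_YM M tinv = integral_M M L3]].
Proof.
case: wb_symplectic => wb_form _ wb_nondeg.
have [R1 R2 R3] := remainders_O_F3 wb_form wb_nondeg s_sign wb_selfdual.
(* The remainders depend only on the metric, the background and [s], so they can be fixed before
   [A]. *)
exists (fun i u => remainder1 (induced_metric M i u) (wb i u)),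
  (fun i u => remainder2 (induced_metric M i u) (wb i u)),
  (fun i u => remainder3 (induced_metric M i u) (wb i u) s).
split; [exact: R1 | exact: R2 | exact: R3 |] => A _ _ g F tinv h sigmab Fs L1 L2 L3.
(* The identities hold because the remainders are defined as differences; the content lies in their
   being O(F^3). *)
have E1 i u : YM_lagrangian (g i u) (tinv i u) = L1 i u.
  by rewrite /L1 /remainder1 addrC subrK.
have E2 i u : YM_lagrangian (g i u) (tinv i u) = L2 i u.
  by rewrite /L2 /remainder2 addrC subrK.
have E3 i u : YM_lagrangian (g i u) (tinv i u) = L3 i u.
  by rewrite /L3 /remainder3 addrC subrK.
split; first by move=> i u _; split; [exact: E1 | exact: E2 | exact: E3].
rewrite /S_YM; split; congr integral_M.
- by apply/funext => i; apply/funext => u; exact: E1.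
- by apply/funext => i; apply/funext => u; exact: E2.
- by apply/funext => i; apply/funext => u; exact: E3.
Qed.
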